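(* The family $\{T_n\mid n\ge0\}$, $T_n\in CU_{2n+1}S^1$, satisfies the following properties. 1. $dT_0=0$, and $0\neq[T_0]$ in $H_1S^1$. 2. $dT_n=\sum_{i=1}^nT_{i-1}T_{n-i}$ for all $n>0$. 3. Every $T_n$ is primitive in $CU_*S^1$.
   Context: Coefficients are in a commutative ring $\Bbbk$ with $1\neq0$. $CU_*X$ is the (normalized, i.e. modulo degenerate cubes) cubical chain complex of a space $X$, with differential $dT=\sum_{i=1}^n(-1)^i\big(T|_{\text{$i$-th coordinate}=0}-T|_{\text{$i$-th coordinate}=1}\big)$ on an $n$-cube $T:I^n\to X$, and with the usual coassociative cubical (Serre) comultiplication $\delta_X(T)=\sum_{P\sqcup Q=\{1,\dots,n\}}\pm\, T|_{t_q=0,\,q\in Q}\otimes T|_{t_p=1,\,p\in P}$, where the sign is that of the shuffle $(P,Q)$. $CU_*S^1$ is a chain Hopf algebra with product $(T\cdot S)(t,s)=T(t)S(s)$ on cubes and unit the $0$-cube at $1\in S^1\subset\mathbb C$; $x$ is primitive if $\delta_{S^1}(x)=x\otimes1+1\otimes x$. The chains $T_n$: in $CU_*\mathbb R$, with product $(A\cdot B)(t,s)=A(t)+B(s)$ on cubes and the linear operation $\sigma(A)(t_0,\dots,t_n)=t_0\,A(t_1,\dots,t_n)$ on $n$-cubes $A$, put $\widetilde T_0(t)=t$ and $\widetilde T_n=\sigma\big(\sum_{i=1}^n\widetilde T_{i-1}\cdot\widetilde T_{n-i}\big)$ for $n\ge1$; $T_n$ is the image of $\widetilde T_n$ under the map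 $CU_*\mathbb R\to CU_*S^1$ induced by $x\mapsto e^{2\pi i x}$. E.g. $T_0(t)=e^{2\pi i t}$, $T_1(t_0,t_1,t_2)=e^{2\pi i t_0(t_1+t_2)}$. *)

(* Defs.v *)
From HB Require Import structures.
(* [freeg] comes first so that its [lift] does not shadow [fintype.lift]. *)
From mathcomp Require Import freeg.
From mathcomp Require Import all_boot all_order all_algebra.
From mathcomp Require Import generic_quotient ring_quotient complex.
From mathcomp Require Import all_classical all_reals all_analysis.
Import Order.TTheory GRing.Theory Num.Theory numFieldNormedType.Exports.

Set Implicit Arguments.
Unset Strict Implicit.
Unset Printing Implicit Defensive.

Local Open Scope classical_set_scope.
Local Open Scope ring_scope.
Local Open Scope quotient_scope.

Section Span.
Context {k : comNzRingType} {V : lmodType k}.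

Definition submod_span (S : set V) : {pred V} :=
  [pred x | `[< smallest (fun N : set V => submod_closed (mem N)) S x >]].

Lemma span_gen (S : set V) x : S x -> x \in submod_span S.
Proof. by move=> Sx; apply/asboolP => N [_]; apply. Qed.

Lemma span_submod_closed (S : set V) : submod_closed (submod_span S).
Proof.
split; first by apply/asboolP => N [[N0 _] _]; exact: set_mem.
move=> a x y /asboolP Sx /asboolP Sy; apply/asboolP => N NS.
have Nx : x \in mem N by apply: mem_set; exact: Sx.
have Ny : y \in mem N by apply: mem_set; exact: Sy.
by apply: set_mem; case: NS => -[_ +] _; apply.
Qed.

HB.instance Definition _ S :=
  GRing.isSubmodClosed.Build k V (submod_span S) (span_submod_closed S).

Lemma span_min (S : set V) (N : {pred V}) :
  submod_closed N -> (forall x, S x -> x \in N) -> {subset submod_span S <= N}.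
Proof.
move=> hN SN x /asboolP /(_ [set y | y \in N]); apply; split => //.
case: hN => N0 hN; split; first exact: mem_set.
by move=> a u v /set_mem Nu /set_mem Nv; apply: mem_set; exact: hN.
Qed.

End Span.

Section Submodule.
Context {k : comNzRingType} {V : lmodType k} (I : submodClosed V).

Definition submodule : Type := {x : V | x \in I}.
HB.instance Definition _ := [isSub for (@sval V _ : submodule -> V)].
HB.instance Definition _ := [Choice of submodule by <:].
HB.instance Definition _ := [SubChoice_isSubLmodule of submodule by <:].

End Submodule.

Section QuotientModule.
Context {k : comNzRingType} {V : lmodType k} (I : submodClosed V).

(* [submodClosed] does not inherit from [zmodClosed], which [Quotient.quot]
   requires. *)
Definition submod_zmod : {pred V} := I.
HB.instance Definition _ := GRing.isZmodClosed.Build V submod_zmod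
  (GRing.submod_closedB (GRing.submodClosedP I)).

Definition quotmod : Type := Quotient.quot submod_zmod.
HB.instance Definition _ := GRing.Zmodule.on quotmod.
HB.instance Definition _ := Quotient.on quotmod.

Definition quotmod_pi (x : V) : quotmod := \pi_quotmod x.

Lemma quotmod_pi_eq x y : quotmod_pi x = quotmod_pi y <-> x - y \in I.
Proof. by split=> [/eqP|h]; [|apply/eqP]; rewrite -(Quotient.idealrBE submod_zmod). Qed.

Lemma quotmod_repr (x : quotmod) : quotmod_pi (repr x) = x.
Proof. exact: reprK. Qed.

Lemma quotmod_pi_repr x : repr (quotmod_pi x) - x \in I.
Proof. by apply/quotmod_pi_eq; rewrite quotmod_repr. Qed.

Lemma quotmod_piD x y : quotmod_pi (x + y) = quotmod_pi x + quotmod_pi y.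
Proof. exact: (Quotient.pi_add submod_zmod). Qed.

Definition quotmod_scale (a : k) (x : quotmod) := quotmod_pi (a *: repr x).

Lemma quotmod_piZ a x : quotmod_pi (a *: x) = quotmod_scale a (quotmod_pi x).
Proof.
by apply/esym/quotmod_pi_eq; rewrite -scalerBr rpredZ ?quotmod_pi_repr.
Qed.

Fact quotmod_scaleA a b x :
  quotmod_scale a (quotmod_scale b x) = quotmod_scale (a * b) x.
Proof. by rewrite -[x]quotmod_repr -!quotmod_piZ scalerA. Qed.

Fact quotmod_scale1 : left_id 1 quotmod_scale.
Proof. by move=> x; rewrite -[x]quotmod_repr -!quotmod_piZ scale1r. Qed.

Fact quotmod_scaleDr : right_distributive quotmod_scale +%R.
Proof.
move=> a x y; rewrite -[x]quotmod_repr -[y]quotmod_repr.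
by rewrite -quotmod_piD -!quotmod_piZ scalerDr quotmod_piD.
Qed.

Fact quotmod_scaleDl x : {morph quotmod_scale^~ x : a b / a + b}.
Proof.
by move=> a b; rewrite -[x]quotmod_repr -!quotmod_piZ scalerDl quotmod_piD.
Qed.

HB.instance Definition _ := GRing.Zmodule_isLmodule.Build k quotmod
  quotmod_scaleA quotmod_scale1 quotmod_scaleDr quotmod_scaleDl.

Fact quotmod_pi_linear : linear quotmod_pi.
Proof. by move=> a x y; rewrite quotmod_piD quotmod_piZ. Qed.
HB.instance Definition _ :=
  GRing.isLinear.Build k V quotmod _ quotmod_pi quotmod_pi_linear.

Lemma quotmod_pi_eq0 x : quotmod_pi x = 0 <-> x \in I.
Proof. by rewrite -[x in x \in _]subr0 -quotmod_pi_eq linear0. Qed.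

(* The map out of the quotient induced by a linear map that vanishes on [I]. *)
Definition quotmod_lift {W : lmodType k} (f : {linear V -> W})
  (f0 : forall x, x \in I -> f x = 0) (x : quotmod) : W := f (repr x).
Arguments quotmod_lift {W} f f0 x.

Lemma quotmod_lift_pi {W : lmodType k} (f : {linear V -> W}) f0 x :
  quotmod_lift f f0 (quotmod_pi x) = f x.
Proof. by apply/subr0_eq; rewrite -linearB f0 ?quotmod_pi_repr. Qed.

Fact quotmod_lift_linear {W : lmodType k} (f : {linear V -> W}) f0 :
  linear (quotmod_lift f f0).
Proof.
move=> a x y; rewrite -[x]quotmod_repr -[y]quotmod_repr -linearP.
by rewrite !quotmod_lift_pi linearP.
Qed.
HB.instance Definition _ {W : lmodType k} (f : {linear V -> W}) f0 :=
  GRing.isLinear.Build k quotmod W _ (quotmod_lift f f0)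
    (@quotmod_lift_linear W f f0).

End QuotientModule.
Arguments quotmod_lift {k V} I {W} f f0 x.

Section FreeModule.
Context {k : comNzRingType} {K : choiceType} {W : lmodType k} (f : K -> W).

HB.instance Definition _ := GRing.isZmodMorphism.Build {freeg K / k} W
  (fglift f) (lift_is_additive f).

Fact fglift_scalable : scalable (fglift f : {freeg K / k} -> W).
Proof.
move=> a x; rewrite [in LHS]raddf_sum /= -[in RHS](freeg_sumE x) raddf_sum.
rewrite scaler_sumr; apply: eq_bigr => z _. by rewrite /= !liftU scalerA.
Qed.
HB.instance Definition _ := GRing.isScalable.Build k {freeg K / k} W _
  (fglift f) fglift_scalable.

End FreeModule.

Section TensorProduct.
Context {k : comNzRingType} (M N : lmodType k).

Definition tensor_rel : set {freeg (M * N)%type / k} :=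
  [set r | (exists a x x' y,
              r = << (a *: x + x', y) >> - a *: << (x, y) >> - << (x', y) >>)
        \/ (exists a x y y',
              r = << (x, a *: y + y') >> - a *: << (x, y) >> - << (x, y') >>)].

Definition tensor : lmodType k := quotmod (submod_span tensor_rel).

Definition tens (x : M) (y : N) : tensor :=
  quotmod_pi (submod_span tensor_rel) << (x, y) >>.

Lemma tens_linearl y : linear (tens^~ y).
Proof.
move=> a x x'; apply/subr0_eq; rewrite opprD addrA -linearZ -!linearB.
by apply/quotmod_pi_eq0/span_gen; left; exists a, x, x', y.
Qed.

Lemma tens_linearr x : linear (tens x).
Proof.
move=> a y y'; apply/subr0_eq; rewrite opprD addrA -linearZ -!linearB.
by apply/quotmod_pi_eq0/span_gen; right; exists a, x, y, y'.
Qed.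

Lemma tens0l y : tens 0 y = 0.
Proof. by have := tens_linearl y (-1) 0 0; rewrite scaler0 addr0 scaleN1r addNr. Qed.

Lemma tens0r x : tens x 0 = 0.
Proof. by have := tens_linearr x (-1) 0 0; rewrite scaler0 addr0 scaleN1r addNr. Qed.

End TensorProduct.

Section Cubes.
Context (R : realType).

Definition unitI : topologicalType := `[0, 1]%classic : set R.

Fact unitI0_subproof : (0 : R) \in (`[0, 1]%classic : set R).
Proof. by apply: mem_set; rewrite /= in_itv /= lexx ler01. Qed.

Fact unitI1_subproof : (1 : R) \in (`[0, 1]%classic : set R).
Proof. by apply: mem_set; rewrite /= in_itv /= lexx ler01. Qed.

Definition unitI0 : unitI := exist _ 0 unitI0_subproof.
Definition unitI1 : unitI := exist _ 1 unitI1_subproof.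

(* The real line as a space; the annotation fixes which structure of [R] is
   used, so that lemmas on topological spaces apply by rewriting. *)
Definition real_line : topologicalType := R.

Definition unitI_val : unitI -> real_line := set_val.

Lemma unitI_val_continuous : continuous unitI_val.
Proof. exact: initial_continuous. Qed.

Definition cube (n : nat) : topologicalType := {ptws 'I_n -> unitI}.

Lemma cube_coord_continuous n (i : 'I_n) : continuous (fun t : cube n => t i).
Proof. exact: (@proj_continuous 'I_n (fun=> unitI) i). Qed.

Lemma continuous_cube (X : topologicalType) n (f : X -> cube n) :
  (forall i, continuous (fun x => f x i)) -> continuous f.
Proof.
move=> cf x; apply/cvg_sup => i.
apply: (@continuous_comp_initial _ X _ (fun t : cube n => t i) f).
exact: cf.
Qed.

(* The map of cubes whose [j]-th coordinate is the [i]-th coordinate of the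
   argument if [h j = inl i], and the constant [e] if [h j = inr e]. *)
Definition plug_fun m n (h : 'I_n -> 'I_m + unitI) (t : cube m) : cube n :=
  fun j => match h j with inl i => t i | inr e => e end.

Lemma plug_continuous m n (h : 'I_n -> 'I_m + unitI) : continuous (plug_fun h).
Proof.
apply: continuous_cube => j; rewrite /plug_fun.
by case: (h j) => [i|e]; [exact: cube_coord_continuous|exact: cst_continuous].
Qed.

Definition plug m n (h : 'I_n -> 'I_m + unitI) :
  continuousType (cube m) (cube n) := mkcts (@plug_continuous m n h).

Definition scube (X : topologicalType) : choiceType :=
  {n : nat & continuousType (cube n) X}.

Definition mk_scube {X : topologicalType} n (T : cube n -> X)
  (cT : continuous T) : scube X :=
  existT (fun n => continuousType (cube n) X) n (mkcts cT).

Section Operations.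
Context {X : topologicalType}.

Definition cube_dim (T : scube X) : nat := tag T.
Definition scube_fun (T : scube X) : cube (cube_dim T) -> X := tagged T.
Arguments scube_fun : clear implicits.

Lemma scube_continuous (T : scube X) : continuous (scube_fun T).
Proof. exact: cts_fun. Qed.

Definition independent_of n (T : cube n -> X) (i : 'I_n) :=
  forall t t' : cube n, (forall j, j != i -> t j = t' j) -> T t = T t'.

Definition degenerate : set (scube X) :=
  [set T | exists i, independent_of (scube_fun T) i].

Definition precomp (T : scube X) m (phi : continuousType (cube m) (cube (cube_dim T)))
  : scube X :=
  mk_scube (fun t => continuous_comp (@cts_fun _ _ phi t)
                       (@scube_continuous T (phi t))).

Lemma plug_independent m n (T : cube n -> X) (h : 'I_n -> 'I_m + unitI) j i :
  independent_of T j -> (forall j', h j' = inl i -> j' = j) ->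
  independent_of (T \o plug h) i.
Proof.
move=> Tj hi t t' tt'; apply: Tj => j' j'j; rewrite /= /mkcts /plug_fun.
case E: (h j') => [i'|//]; apply: tt'.
by apply: contra_neq j'j => ii'; apply: hi; rewrite E ii'.
Qed.

Definition cube_face (T : scube X) (i : 'I_(cube_dim T)) (e : unitI) : scube X :=
  precomp (plug (fun j => if unlift i j is Some j' then inl j' else inr e)).

(* The coordinates in [P], in increasing order, are kept; the others are set
   to [e]. *)
Definition cube_restrict (T : scube X) (P : {set 'I_(cube_dim T)}) (e : unitI) : scube X :=
  precomp (plug (fun j => if [pick a : 'I_#|P| | enum_val a == j] is Some a
                          then inl a else inr e)).

Lemma face_degenerate (T : scube X) (i j : 'I_(cube_dim T)) e :
  independent_of (scube_fun T) j -> i != j -> degenerate (cube_face i e).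
Proof.
move=> Tj ij; have [j' jj' _] := unlift_some ij.
exists j'; apply: (plug_independent Tj) => l.
by case: unliftP => [l' ->|//] [->].
Qed.

Lemma face_independent (T : scube X) (i : 'I_(cube_dim T)) e e' :
  independent_of (scube_fun T) i -> cube_face i e = cube_face i e'.
Proof.
move=> Ti; congr existT; apply/continuousEP => t /=; apply: Ti => j ji.
by rewrite /= /mkcts /plug_fun; case: unliftP => // E; rewrite E eqxx in ji.
Qed.

Lemma restrict_degenerate (T : scube X) (P : {set 'I_(cube_dim T)}) e j :
  independent_of (scube_fun T) j -> j \in P -> degenerate (cube_restrict P e).
Proof.
move=> Tj jP; exists (enum_rank_in jP j); apply: (plug_independent Tj) => l.
case: pickP => [a /eqP <- [->]|//].
by rewrite enum_rankK_in.
Qed.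

Lemma scube_prod_continuous (mu : continuousType (X * X)%type X) (S T : scube X) :
  continuous (fun t : cube (cube_dim S + cube_dim T) =>
    mu (scube_fun S (fun i => t (lshift _ i)), scube_fun T (fun i => t (rshift _ i)))).
Proof.
move=> t; set m := cube_dim S; set n := cube_dim T.
have cl : continuous (fun t : cube (m + n) => (fun i => t (lshift n i)) : cube m).
  by apply: continuous_cube => i; exact: cube_coord_continuous.
have cr : continuous (fun t : cube (m + n) => (fun i => t (rshift m i)) : cube n).
  by apply: continuous_cube => i; exact: cube_coord_continuous.
have cp : {for t, continuous (fun t : cube (m + n) =>
    (scube_fun S (fun i => t (lshift n i)), scube_fun T (fun i => t (rshift m i))))}.
  exact: (cvg_pair (continuous_comp (cl t) (@scube_continuous S _))
                   (continuous_comp (cr t) (@scube_continuous T _))).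
exact: (continuous_comp cp (@cts_fun _ _ mu _)).
Qed.

Definition scube_prod (mu : continuousType (X * X)%type X) (S T : scube X) : scube X :=
  mk_scube (@scube_prod_continuous mu S T).

Lemma scube_prod_degeneratel mu (S T : scube X) :
  degenerate S -> degenerate (scube_prod mu S T).
Proof.
case=> i Si; exists (lshift _ i) => t t' tt'; rewrite /scube_fun /= /mkcts.
congr (mu (_, _)).
  by apply: Si => j ji; apply: tt'; rewrite (inj_eq (@lshift_inj _ _)).
congr (tagged T _); apply/funext => j; apply: tt'.
by rewrite eq_rlshift.
Qed.

Lemma scube_prod_degenerater mu (S T : scube X) :
  degenerate T -> degenerate (scube_prod mu S T).
Proof.
case=> i Ti; exists (rshift _ i) => t t' tt'; rewrite /scube_fun /= /mkcts.
congr (mu (_, _)); last first.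
  by apply: Ti => j ji; apply: tt'; rewrite (inj_eq (@rshift_inj _ _)).
congr (tagged S _); apply/funext => j; apply: tt'.
by rewrite eq_lrshift.
Qed.

Definition point_cube (x : X) : scube X := mk_scube (@cst_continuous (cube 0) X x).

End Operations.
Arguments scube_fun {X} T t.

Definition scube_map {X Y : topologicalType} (f : continuousType X Y)
  (T : scube X) : scube Y :=
  mk_scube (fun t => continuous_comp (@scube_continuous X T t)
                       (@cts_fun _ _ f (scube_fun T t))).

Lemma scube_map_degenerate {X Y : topologicalType} (f : continuousType X Y) T :
  degenerate T -> degenerate (scube_map f T).
Proof. by case=> i Ti; exists i => t t' tt'; congr (f _); exact: Ti. Qed.

Fact interval_cube_continuous :
  continuous (fun t : cube 1 => unitI_val (t ord0)).
Proof.
move=> t; exact: (continuous_comp (@cube_coord_continuous 1 ord0 t)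
                                  (@unitI_val_continuous _)).
Qed.

Definition interval_cube : scube real_line := mk_scube interval_cube_continuous.

Lemma scube_cone_continuous (A : scube real_line) :
  continuous (fun t : cube (cube_dim A).+1 =>
    ((unitI_val (t ord0) : R) * scube_fun A (fun i => t (lift ord0 i)) : real_line)).
Proof.
move=> t; have ct : continuous (fun t : cube (cube_dim A).+1 =>
    (fun i => t (lift ord0 i)) : cube (cube_dim A)).
  by apply: continuous_cube => i; exact: cube_coord_continuous.
exact: (cvgM (continuous_comp (cube_coord_continuous (x:=t))
                              (@unitI_val_continuous _))
             (continuous_comp (ct t) (@scube_continuous real_line A _))).
Qed.

Definition scube_cone (A : scube real_line) : scube real_line :=
  mk_scube (@scube_cone_continuous A).

Lemma scube_cone_degenerate (A : scube real_line) :
  degenerate A -> degenerate (scube_cone A).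
Proof.
case=> i Ai; exists (lift ord0 i) => t t' tt'; rewrite /scube_fun /= /mkcts.
congr (unitI_val _ * _); first by apply: tt'; exact: neq_lift.
by apply: Ai => j ji; apply: tt'; rewrite (inj_eq lift_inj).
Qed.

End Cubes.
Arguments scube_fun {R X} T t.
Arguments degenerate {R X}.

Section Chains.
Context {R : realType} {k : comNzRingType}.

Section Lift.
Context {X : topologicalType}.

Definition degenerate_chains : {pred {freeg (scube R X) / k}} :=
  submod_span [set << T >> | T in degenerate].
HB.instance Definition _ := GRing.SubmodClosed.on degenerate_chains.

(* The direct sum over [n] of the modules of normalized [n]-chains. *)
Definition CU : lmodType k := quotmod degenerate_chains.

Definition cube_class (T : scube R X) : CU := quotmod_pi degenerate_chains << T >>.

Lemma cube_class_degenerate T : degenerate T -> cube_class T = 0.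
Proof. by move=> dT; apply/quotmod_pi_eq0/span_gen; exists T. Qed.

Section CULift.
Context {W : lmodType k} (f : scube R X -> W).
Context (f0 : forall T, degenerate T -> f T = 0).

Fact CU_lift_subproof x : x \in degenerate_chains -> fglift f x = 0.
Proof.
have -> : (fglift f x = 0) <-> x \in [pred y | fglift f y == 0].
  by rewrite inE; split=> [->|/eqP].
apply: span_min x.
  split=> [|a x y]; rewrite !inE ?linear0 // => /eqP x0 /eqP y0.
  by rewrite linearP /= x0 y0 scaler0 addr0.
by move=> _ [T dT <-]; rewrite inE liftU f0 ?scaler0.
Qed.

Definition CU_lift : {linear CU -> W} :=
  quotmod_lift degenerate_chains (fglift f) CU_lift_subproof.

Lemma CU_liftE T : CU_lift (cube_class T) = f T.
Proof.
by rewrite -[RHS]scale1r -liftU; exact: quotmod_lift_pi.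
Qed.

Lemma CU_lift0 x : (forall T, f T = 0) -> CU_lift x = 0.
Proof.
move=> fT; rewrite /CU_lift /= /quotmod_lift -[repr x]freeg_sumE raddf_sum.
by apply: big1 => T _; rewrite /= liftU fT scaler0.
Qed.

End CULift.
End Lift.

Arguments CU X : clear implicits.

(* The submodule of homogeneous chains of degree [n]. *)
Definition CU_deg (X : topologicalType) (n : nat) : {pred CU X} :=
  submod_span [set cube_class T | T in [set T : scube R X | cube_dim T = n]].
Arguments CU_deg : clear implicits.
HB.instance Definition _ X n := GRing.SubmodClosed.on (CU_deg X n).

(* Coordinates are numbered from 0, hence the exponent [i.+1]. *)
Definition CU_d_cube {X : topologicalType} (T : scube R X) : CU X :=
  \sum_(i < cube_dim T) (-1) ^+ i.+1 *:
    (cube_class (cube_face i (unitI0 R)) - cube_class (cube_face i (unitI1 R))).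

Fact CU_d_cube_degenerate {X : topologicalType} (T : scube R X) :
  degenerate T -> CU_d_cube T = 0.
Proof.
case=> j Tj; apply: big1 => i _; have [->|ij] := eqVneq i j.
  by rewrite (face_independent _ (unitI1 R) Tj) subrr scaler0.
by rewrite !cube_class_degenerate ?subrr ?scaler0 //; exact: face_degenerate Tj ij.
Qed.

Definition CU_d {X : topologicalType} : {linear CU X -> CU X} :=
  CU_lift (@CU_d_cube_degenerate X).

Lemma CU_dE {X : topologicalType} (T : scube R X) :
  CU_d (cube_class T) = CU_d_cube T.
Proof. exact: CU_liftE. Qed.

(* The sign of the shuffle [(P, ~: P)], i.e. of the permutation listing first
   the elements of [P] and then those of its complement, both increasingly:
   its inversions are the pairs below. *)
Definition shuffle_sign n (P : {set 'I_n}) : k :=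
  (-1) ^+ #|[set pq : 'I_n * 'I_n |
              [&& pq.1 \in P, pq.2 \notin P & (pq.2 < pq.1)%N]]|.

Definition CU_comult_cube {X : topologicalType} (T : scube R X) :
    tensor (CU X) (CU X) :=
  \sum_(P : {set 'I_(cube_dim T)}) shuffle_sign P *:
    tens (cube_class (cube_restrict P (unitI0 R)))
         (cube_class (cube_restrict (~: P) (unitI1 R))).

Fact CU_comult_cube_degenerate {X : topologicalType} (T : scube R X) :
  degenerate T -> CU_comult_cube T = 0.
Proof.
case=> j Tj; apply: big1 => P _; have [jP|jP] := boolP (j \in P).
  rewrite (cube_class_degenerate (restrict_degenerate _ Tj jP)).
  by rewrite tens0l scaler0.
have {}jP : j \in ~: P by rewrite inE.
rewrite (cube_class_degenerate (restrict_degenerate _ Tj jP)).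
by rewrite tens0r scaler0.
Qed.

Definition CU_comult {X : topologicalType} :
    {linear CU X -> tensor (CU X) (CU X)} :=
  CU_lift (@CU_comult_cube_degenerate X).

Lemma CU_comultE {X : topologicalType} (T : scube R X) :
  CU_comult (cube_class T) = CU_comult_cube T.
Proof. exact: CU_liftE. Qed.

(* The product on chains induced by a continuous binary operation [mu] on the
   space. *)
Section Product.
Context {X : topologicalType} (mu : continuousType (X * X)%type X).

Fact CU_mull_degenerate (S T : scube R X) :
  degenerate T -> cube_class (scube_prod mu S T) = 0.
Proof. by move=> dT; exact/cube_class_degenerate/scube_prod_degenerater. Qed.

Definition CU_mull (S : scube R X) : {linear CU X -> CU X} :=
  CU_lift (CU_mull_degenerate S).

Fact CU_mull_eq0 (y : CU X) (S : scube R X) : degenerate S -> CU_mull S y = 0.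
Proof.
move=> dS; apply: CU_lift0 => T.
exact/cube_class_degenerate/scube_prod_degeneratel.
Qed.

Definition CU_mul (x y : CU X) : CU X :=
  CU_lift (f := fun S => CU_mull S y) (CU_mull_eq0 y) x.

Lemma CU_mulE (S T : scube R X) :
  CU_mul (cube_class S) (cube_class T) = cube_class (scube_prod mu S T).
Proof. by rewrite /CU_mul !CU_liftE. Qed.

End Product.

Fact CU_map_degenerate {X Y : topologicalType} (f : continuousType X Y) T :
  degenerate T -> cube_class (scube_map f T) = 0 :> CU Y.
Proof. by move=> dT; exact/cube_class_degenerate/scube_map_degenerate. Qed.

Definition CU_map {X Y : topologicalType} (f : continuousType X Y) :
  {linear CU X -> CU Y} := CU_lift (CU_map_degenerate f).

Lemma CU_mapE {X Y : topologicalType} (f : continuousType X Y) T :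
  CU_map f (cube_class T) = cube_class (scube_map f T).
Proof. exact: CU_liftE. Qed.

Fact sigma_degenerate (A : scube R (real_line R)) :
  degenerate A -> cube_class (scube_cone A) = 0 :> CU (real_line R).
Proof. by move=> dA; exact/cube_class_degenerate/scube_cone_degenerate. Qed.

Definition CU_sigma : {linear CU (real_line R) -> CU (real_line R)} := CU_lift sigma_degenerate.

Lemma CU_sigmaE A : CU_sigma (cube_class A) = cube_class (scube_cone A).
Proof. exact: CU_liftE. Qed.

Definition cycles (X : topologicalType) (n : nat) : {pred CU X} :=
  [pred x | (x \in CU_deg X n) && (CU_d x == 0)].

Arguments cycles : clear implicits.

Fact cycles_submod_closed X n : submod_closed (cycles X n).
Proof.
split=> [|a x y]; first by apply/andP; split; rewrite ?rpred0 ?linear0.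
move=> /andP[xn /eqP x0] /andP[yn /eqP y0]; apply/andP.
by split; rewrite ?rpredD ?rpredZ // linearP x0 y0 scaler0 addr0.
Qed.
HB.instance Definition _ X n :=
  GRing.isSubmodClosed.Build k (CU X) (cycles X n) (@cycles_submod_closed X n).

(* The cycles of degree [n] that are differentials of chains of degree [n.+1]. *)
Definition boundaries (X : topologicalType) (n : nat) :
    {pred submodule (cycles X n)} :=
  [pred z | `[< exists2 y, y \in CU_deg X n.+1 & CU_d y = \val z >]].

Arguments boundaries : clear implicits.

Fact boundaries_submod_closed X n : submod_closed (boundaries X n).
Proof.
split=> [|a x y]; first by apply/asboolP; exists 0; rewrite ?rpred0 ?linear0.
move=> /asboolP[x' x'n dx'] /asboolP[y' y'n dy']; apply/asboolP.
by exists (a *: x' + y'); rewrite ?rpredD ?rpredZ // linearP dx' dy' linearP.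
Qed.
HB.instance Definition _ X n := GRing.isSubmodClosed.Build k
  (submodule (cycles X n)) (boundaries X n) (@boundaries_submod_closed X n).

Definition homology (X : topologicalType) (n : nat) : lmodType k :=
  quotmod (boundaries X n).

Definition homology_class {X : topologicalType} {n : nat}
  (z : submodule (cycles X n)) : homology X n := quotmod_pi (boundaries X n) z.

End Chains.

Arguments CU R k X : clear implicits.
Arguments CU_deg {R k} X n.
Arguments cycles {R k} X n.
Arguments boundaries {R k} X n.
Arguments homology {R} k X n.

Section Circle.
Context (R : realType).

(* [R[i]^o] is [R[i]] with the topology of its norm. *)
Definition circle : topologicalType := [set z : R[i]^o | `|z| = 1].

Definition circle_val : circle -> R[i]^o := set_val.

Definition mk_circle (z : R[i]^o) (z1 : `|z| = 1) : circle :=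
  exist _ z (mem_set z1).

Lemma circle_val_norm (z : circle) : `|circle_val z| = 1.
Proof. exact: (set_mem (valP z)). Qed.

Lemma continuous_circle (X : topologicalType) (f : X -> circle) :
  continuous (circle_val \o f) -> continuous f.
Proof. exact: continuous_comp_initial. Qed.

Fact circle1_subproof : `|1 : R[i]^o| = 1.
Proof. exact: normr1. Qed.

Definition circle1 : circle := mk_circle circle1_subproof.

Fact circle_mul_subproof (p : circle * circle) :
  `|circle_val p.1 * circle_val p.2 : R[i]^o| = 1.
Proof. by rewrite normrM !circle_val_norm mulr1. Qed.

Definition circle_mul_fun (p : circle * circle) : circle :=
  mk_circle (circle_mul_subproof p).

Lemma circle_mul_continuous : continuous circle_mul_fun.
Proof.
have cv : continuous circle_val by exact: initial_continuous.
have c1 : continuous (fst : circle * circle -> circle) by move=> ?; exact: cvg_fst.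
have c2 : continuous (snd : circle * circle -> circle) by move=> ?; exact: cvg_snd.
apply: continuous_circle => p.
exact: (cvgM (continuous_comp (c1 p) (cv _)) (continuous_comp (c2 p) (cv _))).
Qed.

Definition circle_mul : continuousType (circle * circle)%type circle :=
  mkcts circle_mul_continuous.

Fact real_add_continuous : continuous
  (fun p : real_line R * real_line R => (p.1 : R) + p.2 : real_line R).
Proof. by move=> p; apply: cvgD; [exact: cvg_fst|exact: cvg_snd]. Qed.

Definition real_add : continuousType (real_line R * real_line R)%type (real_line R) :=
  mkcts real_add_continuous.

Fact exp2pi_subproof (x : R) :
  `|(cos (2 * pi * x) +i* sin (2 * pi * x))%C : R[i]^o| = 1.
Proof. by rewrite normc_def /= cos2Dsin2 sqrtr1. Qed.

(* $x \mapsto e^{2 \pi i x}$ *)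
Definition exp2pi_fun (x : real_line R) : circle := mk_circle (exp2pi_subproof x).

Lemma exp2pi_continuous : continuous exp2pi_fun.
Proof.
have cR (f : R -> R) : continuous f -> continuous (fun x => (f x)%:C%C : R[i]^o).
  move=> cf x; apply/cvgrPdist_lt => e e0.
  have [e' e'0 ->] : exists2 e', 0 < e' & e = e'%:C%C.
    case: e e0 => a b; rewrite ltcE /= => /andP[b0 a0].
    by exists a; rewrite // (eqP b0).
  have /cvgrPdist_lt/(_ _ e'0) := cf x; apply: filterS => y.
  by rewrite -rmorphB /= normc_def /= expr0n /= addr0 sqrtr_sqr ltcR.
apply: continuous_circle.
have c2 : continuous (fun x : R => 2 * pi * x) by exact: mulrl_continuous.
have cc := cR _ (fun x => continuous_comp (c2 x) (@continuous_cos R _)).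
have cs := cR _ (fun x => continuous_comp (c2 x) (@continuous_sin R _)).
suff -> : circle_val \o exp2pi_fun = fun x : R =>
    ((cos (2 * pi * x))%:C + 'i * (sin (2 * pi * x))%:C)%C : R[i]^o.
  move=> x; apply: cvgD; first exact: cc.
  by apply: cvgM; [exact: cvg_cst|exact: cs].
by apply/funext => x /=; rewrite /circle_val /=; simpc.
Qed.

Definition exp2pi : continuousType (real_line R) circle := mkcts exp2pi_continuous.

End Circle.

Section TChains.
Context (R : realType) (k : comNzRingType).

Definition Ttilde0 : CU R k (real_line R) := cube_class (interval_cube R).

(* The list of the chains of index at most [n]. *)
Fixpoint Ttilde_seq (n : nat) : seq (CU R k (real_line R)) :=
  if n is m.+1 then
    let s := Ttilde_seq m in
    rcons s (CU_sigma (\sum_(1 <= i < n.+1) CU_mul (real_add R) s`_i.-1 s`_(n - i)))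
  else [:: Ttilde0].

Definition Ttilde (n : nat) : CU R k (real_line R) := (Ttilde_seq n)`_n.

Lemma size_Ttilde_seq n : size (Ttilde_seq n) = n.+1.
Proof. by elim: n => //= n IHn; rewrite size_rcons IHn. Qed.

Lemma nth_Ttilde_seq m n : (m <= n)%N -> (Ttilde_seq n)`_m = Ttilde m.
Proof.
elim: n => [|n IHn]; first by rewrite leqn0 => /eqP->.
rewrite leq_eqVlt => /predU1P[->//|mn].
by rewrite /= nth_rcons size_Ttilde_seq mn IHn.
Qed.

Lemma TtildeE n : (0 < n)%N ->
  Ttilde n =
  CU_sigma (\sum_(1 <= i < n.+1) CU_mul (real_add R) (Ttilde i.-1) (Ttilde (n - i))).
Proof.
case: n => // n _; rewrite {1}/Ttilde /= nth_rcons size_Ttilde_seq ltnn eqxx.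
congr (CU_sigma _); apply: eq_big_nat => -[//|i] /= iN.
by rewrite !nth_Ttilde_seq // subSS leq_subr.
Qed.

Definition T_chain (n : nat) : CU R k (circle R) := CU_map (exp2pi R) (Ttilde n).

Definition circle_unit : CU R k (circle R) := cube_class (point_cube R (circle1 R)).

Definition CU_primitive (x : CU R k (circle R)) :=
  CU_comult x = tens x circle_unit + tens circle_unit x.

End TChains.

(* Main.v *)
(* Everything but the nontriviality of $[T_0]$ already holds, in a corrected
   form, for the chains $\widetilde T_n$ in $CU_*\mathbb R$, and is pushed forward
   along the homomorphism $e^{2\pi i x}$. With $A_n = \sum_{i \le n}
   \widetilde T_i \widetilde T_{n-i}$ one has $\widetilde T_{n+1} = \sigma(A_n)$ and
   $d\sigma(A) = A - \sigma(dA)$ in positive degrees. By induction $dA_n = 0$: the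
   triple products cancel by associativity, and the two terms coming from
   $d\widetilde T_0 = [1] - [0]$ cancel because 0-cubes are central. For the
   coproduct, $\delta\sigma(A) = [0] \otimes \sigma(A) + (\sigma \otimes 1)\delta(A)$,
   and $\delta\widetilde T_n = \widetilde T_n \otimes [n+1] + [0] \otimes \widetilde T_n$
   because the mixed terms of $\delta A_n$ cancel in pairs, all $\widetilde T_i$
   being of odd degree. In $S^1$ the points $n+1$ and $0$ become $1$.
   Finally, $T \mapsto \lfloor\theta(1)\rfloor - \lfloor\theta(0)\rfloor$, for a
   lift $\theta$ to $\mathbb R$ of the 1-cube $T$, is a well defined cocycle taking
   the value 1 on $T_0$. *)
Require Import Defs.
From HB Require Import structures.
From mathcomp Require Import freeg.
From mathcomp Require Import all_boot all_order all_algebra.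
From mathcomp Require Import complex ring lra zify.
From mathcomp Require Import all_classical all_reals all_analysis.
(* Last, so that [set0], [setT] and [inE] are those of finite sets. *)
From mathcomp Require Import finset.
Import Order.TTheory GRing.Theory Num.Theory numFieldNormedType.Exports.

Set Implicit Arguments.
Unset Strict Implicit.
Unset Printing Implicit Defensive.

Local Open Scope ring_scope.

(** * Equality of singular cubes, of their faces and of their restrictions *)

Section CubeEquality.
Context {R : realType} {X : topologicalType}.
Implicit Types S T : scube R X.

Lemma scube_eq S T (E : cube_dim S = cube_dim T) :
  (forall (t : cube R (cube_dim S)) (u : cube R (cube_dim T)),
     (forall (a : 'I_(cube_dim S)) (b : 'I_(cube_dim T)), a = b :> nat -> t a = u b) ->
     scube_fun S t = scube_fun T u) ->
  S = T.
Proof.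
case: T E => m f; case: S => n g /= E; case: _ / E f => f fg.
congr existT; apply/continuousEP => t; apply: fg => i j /ord_inj ->.
by [].
Qed.

(* [cube_face i e] has dimension [(cube_dim T).-1], which is only provably equal
   to the dimension of a given [S]; comparing coordinates by their values in
   [nat] avoids casts between ordinals. *)
Lemma face_eq S T (i : 'I_(cube_dim T)) e :
  (cube_dim T).-1 = cube_dim S ->
  (forall (t : cube R (cube_dim S)) (u : cube R (cube_dim T)),
     (forall (a : 'I_(cube_dim S)) (j : 'I_(cube_dim T)),
        j = bump i a :> nat -> u j = t a) -> u i = e ->
     scube_fun T u = scube_fun S t) ->
  cube_face i e = S.
Proof.
move=> E H; apply: (@scube_eq (cube_face i e) S E) => t u tu.
apply: (H u (plug _ t)) => [a j jE|]; rewrite /= /mkcts /plug_fun.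
  case: unliftP => [j' j'E|jiE].
    by apply: tu; apply: (can_inj (bumpK i)); rewrite -jE j'E.
  by have := neq_bump i a; rewrite -jE jiE eqxx.
by rewrite unlift_none.
Qed.

Lemma enum_val_lt n (P : {set 'I_n}) (a b : 'I_#|P|) :
  (a < b)%N -> (enum_val a < enum_val b)%N.
Proof.
move=> ab; have x0 := enum_val a; rewrite !(enum_val_nth x0).
have s : sorted (relpre val ltn) (enum P).
  rewrite /enum_mem; apply: sorted_filter; first by move=> x y z; exact: ltn_trans.
  by rewrite -enumT -sorted_map val_enum_ord iota_ltn_sorted.
apply: (sorted_ltn_nth _ _ s) => //; first by move=> x y z; exact: ltn_trans.
  by rewrite inE -cardE.
by rewrite inE -cardE.
Qed.

(** A finite set of ordinals has only one strictly increasing enumeration, so any such [h] onto [P]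
    agrees with [enum_val]. Callers can thus supply an explicit [h] and never compute with
    [enum_val] or [pick]. *)
Lemma restrict_eq S T (P : {set 'I_(cube_dim T)}) e
    (h : 'I_(cube_dim S) -> 'I_(cube_dim T)) :
  {homo h : a b / (a < b)%N} -> (forall a, h a \in P) ->
  (forall j, j \in P -> exists a, j = h a) ->
  (forall (t : cube R (cube_dim S)) (u : cube R (cube_dim T)),
     (forall a, u (h a) = t a) -> (forall j, j \notin P -> u j = e) ->
     scube_fun T u = scube_fun S t) ->
  cube_restrict P e = S.
Proof.
move=> hlt hP Ph H.
have hinj : injective h.
  move=> a b ab; apply/ord_inj; case: (ltngtP a b) => // /hlt; rewrite ab ltnn //.
have Eh : [seq enum_val a | a <- enum 'I_#|P|] = [seq h a | a <- enum 'I_(cube_dim S)].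
  have tr : transitive (relpre val ltn : rel 'I_(cube_dim T)).
    by move=> x y z; exact: ltn_trans.
  apply: (irr_sorted_eq tr).
  - by move=> x /=; rewrite ltnn.
  - rewrite sorted_map; apply: (sub_sorted (e := relpre val ltn)).
      by move=> a b; exact: enum_val_lt.
    by rewrite -sorted_map val_enum_ord iota_ltn_sorted.
  - rewrite sorted_map; apply: (sub_sorted (e := relpre val ltn)).
      by move=> a b; exact: hlt.
    by rewrite -sorted_map val_enum_ord iota_ltn_sorted.
  - move=> j; apply/mapP/mapP => [[a _ ->]|[a _ ->]].
      by have [b ->] := Ph _ (enum_valP a); exists b; rewrite ?mem_enum.
    by exists (enum_rank_in (hP a) (h a)); rewrite ?mem_enum ?enum_rankK_in.
have E : #|P| = cube_dim S.
  by have := congr1 size Eh; rewrite size_map size_enum_ord size_map size_enum_ord.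
have hE (a : 'I_#|P|) (b : 'I_(cube_dim S)) : a = b :> nat -> enum_val a = h b.
  move=> ab; have x0 := h b.
  have := congr1 (nth x0 ^~ a) Eh.
  rewrite (nth_map a) ?size_enum_ord // (nth_map b) ?size_enum_ord -?E //.
  by rewrite nth_ord_enum ab nth_ord_enum.
apply: (@scube_eq (cube_restrict P e) S E) => t u tu.
apply: (H u (plug _ t)) => [a|j jP]; rewrite /= /mkcts /plug_fun.
  case: pickP => [b /eqP bE|/(_ (cast_ord (esym E) a))]; last first.
    by rewrite (hE _ a) ?eqxx.
  apply: tu; move: bE.
  by rewrite (hE _ (cast_ord E b)) // => /hinj <-.
by case: pickP => // a /eqP aE; rewrite -aE enum_valP in jP.
Qed.

(** Evaluates a restriction at any point [u] extending [t], which hides the [pick] in the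
    definition; [face_fun] does the same for faces. *)
Lemma restrict_fun T (P : {set 'I_(cube_dim T)}) e t (u : cube R (cube_dim T)) :
  (forall a, u (enum_val a) = t a) -> (forall j, j \notin P -> u j = e) ->
  scube_fun (cube_restrict P e) t = scube_fun T u.
Proof.
move=> ut ue; rewrite {1}/scube_fun /= /mkcts /plug_fun; congr scube_fun.
apply/funext => j; case: pickP => [a /eqP <-|jP]; first by rewrite ut.
rewrite ue //; apply/negP => jP'; have := jP (enum_rank_in jP' j).
by rewrite enum_rankK_in ?eqxx.
Qed.

Lemma face_fun T (i : 'I_(cube_dim T)) e t (u : cube R (cube_dim T)) :
  (forall j, u (lift i j) = t j) -> u i = e ->
  scube_fun (cube_face i e) t = scube_fun T u.
Proof.
move=> ut ue; rewrite {1}/scube_fun /= /mkcts /plug_fun; congr scube_fun.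
by apply/funext => j; case: unliftP => [j' ->|->]; rewrite ?ut ?ue.
Qed.

End CubeEquality.

(** * Universal property, functoriality and arithmetic of the tensor product *)

Section TensorMap.
Context {k : comNzRingType} {M N W : lmodType k} (f : M -> N -> W).
Hypothesis f_linearl : forall y, linear (f^~ y).
Hypothesis f_linearr : forall x, linear (f x).

Fact tensor_lift_subproof r :
  r \in submod_span (@tensor_rel k M N) -> fglift (fun p => f p.1 p.2) r = 0.
Proof.
move=> rS; apply/eqP.
have : r \in [pred s | fglift (fun p => f p.1 p.2) s == 0].
  move: r rS; apply: span_min.
    split=> [|a x y]; rewrite !inE ?linear0 // => /eqP x0 /eqP y0.
    by rewrite linearP /= x0 y0 scaler0 addr0.
  move=> _ [[a [x [x' [y ->]]]]|[a [x [y [y' ->]]]]]; rewrite inE.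
    by rewrite !linearB linearZ /= !liftU !scale1r /= f_linearl -addrA -opprD subrr.
  by rewrite !linearB linearZ /= !liftU !scale1r /= f_linearr -addrA -opprD subrr.
by rewrite inE.
Qed.

Definition tensor_lift : {linear tensor M N -> W} :=
  quotmod_lift (submod_span (@tensor_rel k M N)) _ tensor_lift_subproof.

Lemma tensor_liftE x y : tensor_lift (tens x y) = f x y.
Proof. by rewrite [LHS]quotmod_lift_pi /= liftU scale1r. Qed.

End TensorMap.

Section TensorFunctor.
Context {k : comNzRingType} {M N M' N' : lmodType k}.
Context (f : {linear M -> M'}) (g : {linear N -> N'}).

Fact tmap_linearl y : linear (fun x => tens (f x) (g y)).
Proof. by move=> a x x'; rewrite linearP tens_linearl. Qed.

Fact tmap_linearr x : linear (fun y => tens (f x) (g y)).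
Proof. by move=> a y y'; rewrite linearP tens_linearr. Qed.

Definition tmap : {linear tensor M N -> tensor M' N'} :=
  tensor_lift tmap_linearl tmap_linearr.

Lemma tmapE x y : tmap (tens x y) = tens (f x) (g y).
Proof. exact: tensor_liftE. Qed.

Lemma tmapD u v : tmap (u + v) = tmap u + tmap v.
Proof. exact: linearD. Qed.

Lemma tmapZ a u : tmap (a *: u) = a *: tmap u.
Proof. exact: linearZZ. Qed.

Lemma tmap_sum I (r : seq I) (P : pred I) F :
  tmap (\sum_(i <- r | P i) F i) = \sum_(i <- r | P i) tmap (F i).
Proof. exact: linear_sum. Qed.

End TensorFunctor.

Section TensorArith.
Context {k : comNzRingType} {M N : lmodType k}.

(** A named constant to which a linear structure in the left factor can be attached; [CU_mul_flip]
    below has the same purpose. *)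
Definition tens_flip (y : N) (x : M) : tensor M N := tens x y.

HB.instance Definition _ (y : N) :=
  GRing.isLinear.Build k M (tensor M N) _ (tens_flip y) (tens_linearl y).
HB.instance Definition _ (x : M) :=
  GRing.isLinear.Build k N (tensor M N) _ (@tens k M N x) (tens_linearr x).

Lemma tensZl a (x : M) (y : N) : tens (a *: x) y = a *: tens x y.
Proof. exact: (linearZZ (tens_flip y)). Qed.
Lemma tensZr a (x : M) (y : N) : tens x (a *: y) = a *: tens x y.
Proof. exact: (linearZZ (@tens k M N x)). Qed.
Lemma tens_suml I (r : seq I) (P : pred I) (F : I -> M) (y : N) :
  tens (\sum_(i <- r | P i) F i) y = \sum_(i <- r | P i) tens (F i) y.
Proof. exact: (linear_sum (tens_flip y)). Qed.
Lemma tens_sumr I (r : seq I) (P : pred I) (F : I -> N) (x : M) :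
  tens x (\sum_(i <- r | P i) F i) = \sum_(i <- r | P i) tens x (F i).
Proof. exact: (linear_sum (@tens k M N x)). Qed.
End TensorArith.

(** * Induction on chains and extensionality of linear maps *)

Section ChainInduction.
Context {R : realType} {k : comNzRingType} {X : topologicalType}.

(** A representative of [x] in the free module is a finite linear combination of cubes. *)
Lemma CU_ind (P : CU R k X -> Prop) :
  P 0 -> (forall a x y, P x -> P y -> P (a *: x + y)) ->
  (forall T, P (cube_class T)) -> forall x, P x.
Proof.
move=> P0 PD PT x; rewrite -[x]quotmod_repr -[repr x]freeg_sumE linear_sum /=.
elim/big_rec: _ => // T y _ Py.
have -> : << coeff T (repr x) *g T >> = coeff T (repr x) *: << T >>
    :> {freeg (scube R X) / k}.
  by apply/eqP/freeg_eqP => S; rewrite coeff_fgscale !coeffU mul1r.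
rewrite linearZ /=; apply: PD => //; exact: PT.
Qed.

(** Linearity is a hypothesis on plain functions, so that the lemma applies to any expression in one
    chain variable. *)
Lemma CU_linear_ext (W : lmodType k) (f g : CU R k X -> W) :
  linear f -> linear g -> (forall T, f (cube_class T) = g (cube_class T)) -> f =1 g.
Proof.
move=> lf lg fg; apply: CU_ind => [|a x y fx fy|]; last exact: fg.
  have := lf (-1) 0 0; have := lg (-1) 0 0.
  by rewrite !scaler0 !addr0 !scaleN1r !addNr => -> ->.
by rewrite lf lg fx fy.
Qed.

Lemma CU_deg_ind n (P : CU R k X -> Prop) :
  P 0 -> (forall a x y, P x -> P y -> P (a *: x + y)) ->
  (forall T, cube_dim T = n -> P (cube_class T)) ->
  forall x, x \in CU_deg X n -> P x.
Proof.
move=> P0 PD PT x xn.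
suff /asboolP : x \in [pred y | `[< P y >]] by [].
move: x xn; apply: span_min.
  split=> [|a x y]; first exact/asboolP.
  by move=> /asboolP Px /asboolP Py; apply/asboolP; exact: PD.
by move=> _ [T Tn <-]; apply/asboolP/PT.
Qed.

Lemma cube_class_deg (T : scube R X) : cube_class T \in CU_deg (k := k) X (cube_dim T).
Proof. by apply: span_gen; exists T. Qed.

End ChainInduction.

(** * The product of chains: bilinearity, degree, associativity *)

Section Mul.
Context {R : realType} {k : comNzRingType} {X : topologicalType}.
Variable mu : continuousType (X * X)%type X.
Local Notation CU := (CU R k X).
Local Notation "x ** y" := (CU_mul mu x y) (at level 40, left associativity).

Fact CU_mul_linearl (y : CU) : linear (CU_mul mu ^~ y).
Proof. by move=> a x x'; rewrite /CU_mul linearP. Qed.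

Definition CU_mul_flip (y x : CU) : CU := x ** y.

HB.instance Definition _ (y : CU) :=
  GRing.isLinear.Build k CU CU _ (CU_mul_flip y) (CU_mul_linearl y).
Lemma CU_mul0l (y : CU) : 0 ** y = 0.
Proof. exact: (linear0 (CU_mul_flip y)). Qed.

(** [CU_mul] is a lift in its left argument only. Linearity on the right is therefore proved by
    induction on [x], down to the case of a cube, where [CU_mull S] is linear. *)
Fact CU_mul_linearr (x : CU) : linear (CU_mul mu x).
Proof.
move=> a y y'; move: x; apply: CU_ind => [|b x x' Px Px'|S].
- by rewrite !CU_mul0l scaler0 addr0.
- rewrite !CU_mul_linearl Px Px' !scalerDr !scalerA [b * a]mulrC.
  by rewrite addrACA.
- by rewrite /CU_mul !CU_liftE linearP.
Qed.

HB.instance Definition _ (x : CU) :=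
  GRing.isLinear.Build k CU CU _ (CU_mul mu x) (CU_mul_linearr x).

Lemma CU_mulZl a (x y : CU) : (a *: x) ** y = a *: (x ** y).
Proof. exact: (linearZZ (CU_mul_flip y)). Qed.

Lemma CU_mulBl (x x' y : CU) : (x - x') ** y = x ** y - x' ** y.
Proof. exact: (linearB (CU_mul_flip y)). Qed.

Lemma CU_mulZr a (x y : CU) : x ** (a *: y) = a *: (x ** y).
Proof. exact: (linearZZ (CU_mul mu x)). Qed.

Lemma CU_mulBr (x y y' : CU) : x ** (y - y') = x ** y - x ** y'.
Proof. exact: (linearB (CU_mul mu x)). Qed.

Lemma CU_mul_suml I (r : seq I) (P : pred I) (F : I -> CU) y :
  (\sum_(i <- r | P i) F i) ** y = \sum_(i <- r | P i) F i ** y.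
Proof. exact: (linear_sum (CU_mul_flip y)). Qed.

Lemma CU_mul_sumr I (r : seq I) (P : pred I) (F : I -> CU) x :
  x ** (\sum_(i <- r | P i) F i) = \sum_(i <- r | P i) x ** F i.
Proof. exact: (linear_sum (CU_mul mu x)). Qed.

Lemma CU_mul_deg m n (x y : CU) :
  x \in CU_deg X m -> y \in CU_deg X n -> x ** y \in CU_deg X (m + n).
Proof.
move=> xm yn; move: x xm; apply: CU_deg_ind => [|a x x' Px Px'|S Sm].
- by rewrite CU_mul0l rpred0.
- by rewrite CU_mul_linearl rpredD ?rpredZ.
move: y yn; apply: CU_deg_ind => [|a x x' Px Px'|T Tn].
- by rewrite linear0 rpred0.
- by rewrite CU_mul_linearr rpredD ?rpredZ.
by rewrite CU_mulE -Sm -Tn; exact: cube_class_deg.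
Qed.

Lemma CU_mulA : (forall x y z, mu (x, mu (y, z)) = mu (mu (x, y), z)) ->
  forall x y z : CU, x ** (y ** z) = (x ** y) ** z.
Proof.
move=> muA x y z.
move: x; apply: CU_linear_ext => [a x x'|a x x'|S]; rewrite ?CU_mul_linearl //.
move: y; apply: CU_linear_ext => [a y y'|a y y'|T].
- by rewrite CU_mul_linearl CU_mul_linearr.
- by rewrite CU_mul_linearr CU_mul_linearl.
move: z; apply: CU_linear_ext => [a z z'|a z z'|U]; rewrite ?CU_mul_linearr //.
rewrite !CU_mulE; congr cube_class.
apply: (@scube_eq _ _ (scube_prod mu S (scube_prod mu T U))
         (scube_prod mu (scube_prod mu S T) U)).
  exact: addnA.
move=> t u tu; rewrite [LHS]muA.
congr (mu (mu (scube_fun S _, scube_fun T _), scube_fun U _));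
  apply/funext => j; apply: tu => //=.
by rewrite addnA.
Qed.

End Mul.

(** * Koszul signs, the Leibniz rule, and products with 0-cubes *)

Section Sign.
Context {R : realType} {k : comNzRingType} {X : topologicalType} (p : nat).

Fact CU_sign_degenerate (T : scube R X) :
  degenerate T -> (-1) ^+ (cube_dim T * p) *: cube_class T = 0 :> CU R k X.
Proof. by move=> dT; rewrite cube_class_degenerate ?scaler0. Qed.

(* The Koszul sign for moving a chain past a chain of degree [p]. *)
Definition CU_sign : {linear CU R k X -> CU R k X} := CU_lift CU_sign_degenerate.

Lemma CU_signE T :
  CU_sign (cube_class T) = (-1) ^+ (cube_dim T * p) *: cube_class T.
Proof. exact: CU_liftE. Qed.

Lemma CU_sign_deg n (x : CU R k X) :
  x \in CU_deg X n -> CU_sign x = (-1) ^+ (n * p) *: x.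
Proof.
move: x; apply: CU_deg_ind => [|a x y Px Py|T Tn].
- by rewrite linear0 scaler0.
- by rewrite linearP Px Py scalerDr !scalerA mulrC.
by rewrite CU_signE Tn.
Qed.

End Sign.

Section Leibniz.
Context {R : realType} {k : comNzRingType} {X : topologicalType}.
Variable mu : continuousType (X * X)%type X.
Local Notation CU := (CU R k X).
Local Notation "x ** y" := (CU_mul mu x y) (at level 40, left associativity).

Lemma face_prodl (S T : scube R X) (i : 'I_(cube_dim S)) e :
  @cube_face _ _ (scube_prod mu S T) (lshift (cube_dim T) i) e =
  scube_prod mu (cube_face i e) T.
Proof.
have S0 : (0 < cube_dim S)%N by apply: leq_ltn_trans (ltn_ord i).
have il : (i <= (cube_dim S).-1)%N by rewrite -ltnS prednK.
have E : ((cube_dim S + cube_dim T).-1 = (cube_dim S).-1 + cube_dim T)%N.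
  by rewrite -{1}(prednK S0).
apply: face_eq => [|t u ut ue]; first exact: E.
congr (mu (_, scube_fun T _)).
  by apply/esym; apply: face_fun => // j; exact: ut.
apply/funext => j; apply: ut => /=.
by rewrite /bump (leq_trans il (leq_addr _ _)) add1n -addSn prednK.
Qed.

Lemma face_prodr (S T : scube R X) (i : 'I_(cube_dim T)) e :
  @cube_face _ _ (scube_prod mu S T) (rshift (cube_dim S) i) e =
  scube_prod mu S (cube_face i e).
Proof.
have T0 : (0 < cube_dim T)%N by apply: leq_ltn_trans (ltn_ord i).
have E : ((cube_dim S + cube_dim T).-1 = cube_dim S + (cube_dim T).-1)%N.
  by rewrite -{1}(prednK T0) addnS.
apply: face_eq => [|t u ut ue]; first exact: E.
congr (mu (scube_fun S _, _)).
  apply/funext => j; apply: ut => /=.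
  by rewrite /bump leqNgt (leq_trans (ltn_ord j) (leq_addr _ _)).
apply/esym; apply: face_fun => // j; apply: ut => /=.
by rewrite bumpDl.
Qed.

(** On cubes the faces split into those in a coordinate of the left factor and those in a coordinate
    of the right one. The index of the latter is shifted by the dimension of the left factor, which
    gives the sign [CU_sign 1]. *)
Lemma CU_d_mul (x y : CU) : CU_d (x ** y) = CU_d x ** y + CU_sign 1 x ** CU_d y.
Proof.
move: x; apply: CU_linear_ext => [a x x'|a x x'|S].
- by rewrite CU_mul_linearl [CU_d _]linearP.
- by rewrite [CU_d _]linearP [CU_sign 1 _]linearP !CU_mul_linearl scalerDr addrACA.
move: y; apply: CU_linear_ext => [a y y'|a y y'|T].
- by rewrite CU_mul_linearr linearP.
- by rewrite [CU_d (_ + _)]linearP !CU_mul_linearr scalerDr addrACA.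
rewrite CU_mulE !CU_dE CU_signE {1}/CU_d_cube big_split_ord /= CU_mul_suml CU_mul_sumr.
congr (_ + _); apply: eq_bigr => i _.
  rewrite !face_prodl -!CU_mulE.
  by rewrite CU_mulZl CU_mulBl.
rewrite !face_prodr -!CU_mulE CU_mulZl CU_mulZr CU_mulBr.
by rewrite scalerA muln1 -exprD addnS.
Qed.

(** A 0-cube contributes no coordinate, so exchanging the factors permutes nothing and only the
    values have to commute. *)
Lemma CU_mul_point_comm c (x : CU) :
  (forall z, mu (c, z) = mu (z, c)) ->
  cube_class (point_cube R c) ** x = x ** cube_class (point_cube R c).
Proof.
move=> cz; move: x; apply: CU_linear_ext => [a x x'|a x x'|T].
- by rewrite CU_mul_linearr.
- by rewrite CU_mul_linearl.
rewrite !CU_mulE; congr cube_class.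
apply: (@scube_eq _ _ (scube_prod mu (point_cube R c) T)
   (scube_prod mu T (point_cube R c))).
  exact: addnC.
move=> t u tu; rewrite [LHS]cz.
by congr (mu (scube_fun T _, c)); apply/funext => j; apply: tu.
Qed.

Lemma CU_mul_unit c (x : CU) :
  (forall z, mu (z, c) = z) -> x ** cube_class (point_cube R c) = x.
Proof.
move=> cz; move: x; apply: CU_linear_ext => [a x x'|a x x'|T] //.
  by rewrite CU_mul_linearl.
rewrite !CU_mulE; congr cube_class.
apply: (@scube_eq _ _ (scube_prod mu T (point_cube R c)) T).
  exact: addn0.
move=> t u tu; rewrite [LHS]cz.
by congr (scube_fun T _); apply/funext => j; apply: tu.
Qed.

Lemma CU_mul_points c d :
  cube_class (point_cube R c) ** cube_class (point_cube R d) =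
  cube_class (point_cube R (mu (c, d))) :> CU.
Proof.
rewrite CU_mulE; congr cube_class.
by apply: (@scube_eq _ _ (scube_prod mu (point_cube R c) (point_cube R d))
             (point_cube R (mu (c, d)))).
Qed.

End Leibniz.

(** * Compatibility of induced maps with degree, differential, coproduct and product *)

Section Naturality.
Context {R : realType} {k : comNzRingType} {X Y : topologicalType}.
Variable f : continuousType X Y.

Lemma CU_map_deg n (x : CU R k X) : x \in CU_deg X n -> CU_map f x \in CU_deg Y n.
Proof.
move: x; apply: CU_deg_ind => [|a x y Px Py|T Tn].
- by rewrite linear0 rpred0.
- by rewrite linearP rpredD ?rpredZ.
by rewrite CU_mapE -Tn; exact: (cube_class_deg (scube_map f T)).
Qed.

Lemma scube_map_face (T : scube R X) (i : 'I_(cube_dim T)) e :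
  scube_map f (cube_face i e) = @cube_face _ _ (scube_map f T) i e.
Proof. by congr existT; apply/continuousEP. Qed.

Lemma scube_map_restrict (T : scube R X) (P : {set 'I_(cube_dim T)}) e :
  scube_map f (cube_restrict P e) = @cube_restrict _ _ (scube_map f T) P e.
Proof. by congr existT; apply/continuousEP. Qed.

Lemma CU_map_d (x : CU R k X) : CU_map f (CU_d x) = CU_d (CU_map f x).
Proof.
move: x; apply: CU_linear_ext => [a x y|a x y|T]; rewrite ?linearP //.
rewrite CU_mapE !CU_dE linear_sum; apply: eq_bigr => i _.
by rewrite linearZZ linearB !CU_mapE !scube_map_face.
Qed.

Lemma CU_map_comult (x : CU R k X) :
  CU_comult (CU_map f x) = tmap (CU_map f) (CU_map f) (CU_comult x).
Proof.
move: x; apply: CU_linear_ext => [a x y|a x y|T]; rewrite ?linearP //.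
rewrite CU_mapE !CU_comultE tmap_sum; apply: eq_bigr => P _.
by rewrite tmapZ tmapE !CU_mapE !scube_map_restrict.
Qed.

Lemma CU_map_mul (mu : continuousType (X * X)%type X)
    (nu : continuousType (Y * Y)%type Y) (x y : CU R k X) :
  (forall a b, f (mu (a, b)) = nu (f a, f b)) ->
  CU_map f (CU_mul mu x y) = CU_mul nu (CU_map f x) (CU_map f y).
Proof.
move=> fM; move: x; apply: CU_linear_ext => [a x x'|a x x'|S].
- by rewrite CU_mul_linearl linearP.
- by rewrite linearP CU_mul_linearl.
move: y; apply: CU_linear_ext => [a y y'|a y y'|T].
- by rewrite CU_mul_linearr linearP.
- by rewrite linearP CU_mul_linearr.
rewrite CU_mulE !CU_mapE CU_mulE; congr cube_class.
apply: (@scube_eq _ _ (scube_map f (scube_prod mu S T))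
  (scube_prod nu (scube_map f S) (scube_map f T))) => // t u tu.
rewrite [LHS]fM.
congr (nu (f (scube_fun S _), f (scube_fun T _))); apply/funext => j; exact: tu.
Qed.

Lemma CU_map_point c :
  CU_map f (cube_class (point_cube R c)) = cube_class (point_cube R (f c)) :> CU R k Y.
Proof.
rewrite CU_mapE; congr cube_class.
by apply: (@scube_eq _ _ (scube_map f (point_cube R c)) (point_cube R (f c))).
Qed.

End Naturality.

(** * The differential of the cone operation *)

Section Cone.
Context {R : realType} {k : comNzRingType}.
Local Notation CU := (CU R k (real_line R)).

(** This face is constantly 0, hence degenerate as soon as it has a coordinate. *)
Lemma face_cone0 (A : scube R (real_line R)) :
  (0 < cube_dim A)%N -> degenerate (@cube_face _ _ (scube_cone A) ord0 (unitI0 R)).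
Proof.
move=> A0; have F t : scube_fun (@cube_face _ _ (scube_cone A) ord0 (unitI0 R)) t = 0 :> R.
  pose u j : unitI R := if unlift ord0 j is Some a then t a else unitI0 R.
  rewrite (@face_fun _ _ (scube_cone A) ord0 _ t u).
  - rewrite [LHS]/(unitI_val (u ord0) * scube_fun A _ : R) /u unlift_none.
    exact: mul0r.
  - by move=> j; rewrite /u liftK.
  - by rewrite /u unlift_none.
by exists (Ordinal A0) => t t' _; rewrite [LHS]F [RHS]F.
Qed.

Lemma face_cone1 (A : scube R (real_line R)) :
  @cube_face _ _ (scube_cone A) ord0 (unitI1 R) = A.
Proof.
apply: face_eq => // t u ut ue.
rewrite [LHS]/(unitI_val (u ord0) * scube_fun A _ : R) ue; apply: etrans (mul1r _) _.
by congr scube_fun; apply/funext => j; exact: ut.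
Qed.

Lemma face_coneS (A : scube R (real_line R)) (i : 'I_(cube_dim A)) e :
  @cube_face _ _ (scube_cone A) (lift ord0 i) e = scube_cone (cube_face i e).
Proof.
have A0 : (0 < cube_dim A)%N by apply: leq_ltn_trans (ltn_ord i).
apply: face_eq => [|t u ut ue]; first by rewrite /= prednK.
rewrite [RHS]/(unitI_val (t ord0) * scube_fun (cube_face i e) _ : R).
rewrite -(ut ord0 ord0) //; congr (_ * _ : R).
apply/esym; apply: face_fun => // j; apply: ut => /=.
by rewrite /bump /= !add1n ltnS addnS.
Qed.

Lemma CU_sigma_deg n (x : CU) :
  x \in CU_deg (real_line R) n -> CU_sigma x \in CU_deg (real_line R) n.+1.
Proof.
move: x; apply: CU_deg_ind => [|a x y Px Py|T Tn].
- by rewrite linear0 rpred0.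
- by rewrite linearP rpredD ?rpredZ.
by rewrite CU_sigmaE -Tn; exact: (cube_class_deg (scube_cone T)).
Qed.

(** In the cone coordinate, the face at 0 is degenerate and the face at 1 is the cube itself. The
    other faces are cones over faces, with index raised by one and hence the opposite sign. Positive
    degree matters: the face at 0 of the cone over a 0-cube is the nonzero chain [[0]]. *)
Lemma CU_d_sigma n (x : CU) :
  x \in CU_deg (real_line R) n.+1 -> CU_d (CU_sigma x) = x - CU_sigma (CU_d x).
Proof.
move: x; apply: CU_deg_ind => [|a x y Px Py|A An].
- by rewrite !linear0 addr0.
- rewrite [CU_d (a *: x + y)]linearP !(linearP CU_sigma) [CU_d (_ + _)]linearP.
  by rewrite Px Py scalerBr opprD addrACA.
rewrite CU_sigmaE !CU_dE {1}/CU_d_cube big_ord_recl face_cone1.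
rewrite cube_class_degenerate; last by apply: face_cone0; rewrite An.
rewrite expr1 sub0r scaleN1r opprK; congr (_ + _).
rewrite linear_sum -sumrN; apply: eq_bigr => i _.
rewrite !face_coneS linearZZ [CU_sigma _]linearB !CU_sigmaE.
by rewrite lift0 exprS mulN1r scaleNr.
Qed.

End Cone.

(** * Shuffle signs, and subsets of a concatenation of two index sets *)

Lemma shuffle_signE (k : comNzRingType) n (P : {set 'I_n}) :
  shuffle_sign (k := k) P =
  (-1) ^+ (\sum_(p < n) \sum_(q < n) [&& p \in P, q \notin P & (q < p)%N])%N.
Proof.
congr (_ ^+ _); rewrite pair_bigA /= -sum1_card big_mkcond /=.
apply: eq_bigr => -[p q] _ /=.
rewrite (_ : (_ \in _) = [&& p \in P, q \notin P & (q < p)%N]); first by case: ifP.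
by apply/idP/idP => [/set_mem|/mem_set].
Qed.

Lemma shuffle_sign0 (k : comNzRingType) n : shuffle_sign (k := k) (set0 : {set 'I_n}) = 1.
Proof.
by rewrite shuffle_signE big1 // => p _; apply: big1 => q _; rewrite inE.
Qed.

Lemma shuffle_signT (k : comNzRingType) n : shuffle_sign (k := k) [set: 'I_n] = 1.
Proof.
by rewrite shuffle_signE big1 // => p _; apply: big1 => q _; rewrite !inE.
Qed.

Section SetJoin.
Context {m n : nat}.
Implicit Types (P : {set 'I_m}) (Q : {set 'I_n}).

Definition set_join P Q : {set 'I_(m + n)} :=
  [set i : 'I_(m + n) |
    match fintype.split i with inl a => a \in P | inr b => b \in Q end].

Lemma set_joinl P Q i : (lshift n i \in set_join P Q) = (i \in P).
Proof. by rewrite inE (unsplitK (inl i)). Qed.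

Lemma set_joinr P Q i : (rshift m i \in set_join P Q) = (i \in Q).
Proof. by rewrite inE (unsplitK (inr i)). Qed.

Lemma setC_join P Q : ~: set_join P Q = set_join (~: P) (~: Q).
Proof. by apply/setP => i; rewrite !inE; case: fintype.split => a; rewrite inE. Qed.

Lemma sum_set_join (V : nmodType) (F : {set 'I_(m + n)} -> V) :
  \sum_P F P = \sum_P \sum_Q F (set_join P Q).
Proof.
rewrite pair_bigA /= (reindex (fun PQ => set_join PQ.1 PQ.2)) //=.
exists (fun P : {set 'I_(m + n)} =>
  ([set i | lshift n i \in P], [set i | rshift m i \in P])) => [[P Q] _|P _] /=.
  by congr pair; apply/setP => i; rewrite inE ?set_joinl ?set_joinr.
apply/setP => i; rewrite -(splitK i); case: fintype.split => a /=.
  by rewrite set_joinl inE.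
by rewrite set_joinr inE.
Qed.

(** Besides the inversions inside each block, every element of [Q] in the right block is inverted
    with every element outside [P] in the left block; no other pair across the blocks is
    inverted. *)
Lemma shuffle_sign_join (k : comNzRingType) P Q :
  shuffle_sign (k := k) (set_join P Q) =
  shuffle_sign P * shuffle_sign Q * (-1) ^+ (#|~: P| * #|Q|).
Proof.
rewrite !shuffle_signE -!exprD; congr (_ ^+ _).
rewrite big_split_ord /=.
under eq_bigr => p _ do rewrite big_split_ord /=.
rewrite big_split /=.
under [X in (_ + X)%N]eq_bigr => p _ do rewrite big_split_ord /=.
rewrite big_split /= [X in (_ + X + _)%N]big1 ?addn0; last first.
  move=> p _; apply: big1 => q _ /=.
  by rewrite ltnNge ltnW ?andbF // (leq_trans (ltn_ord p)) ?leq_addr.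
have -> : (#|~: P| * #|Q| = \sum_(p < n) \sum_(q < m)
  ((p \in Q) && (q \notin P)))%N.
  rewrite mulnC -!sum1_card big_distrl [LHS]big_mkcond; apply: eq_bigr => p _ /=.
  case: ifP => _; last by rewrite big1.
  by rewrite mul1n big_mkcond; apply: eq_bigr => q _; rewrite inE; case: ifP.
rewrite -addnA [X in (_ + X)%N]addnC; congr (_ + (_ + _))%N;
  apply: eq_bigr => p _; apply: eq_bigr => q _;
  rewrite ?set_joinl ?set_joinr //=.
  by rewrite ltn_add2l.
by rewrite (leq_trans (ltn_ord q)) ?leq_addr // andbT.
Qed.

End SetJoin.

(** * The coproduct of a product of chains *)

Section Comultiplication.
Context {R : realType} {k : comNzRingType} {X : topologicalType}.
Variable mu : continuousType (X * X)%type X.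
Local Notation CU := (CU R k X).
Local Notation "x ** y" := (CU_mul mu x y) (at level 40, left associativity).
Local Notation delta := (@CU_comult R k _).

Lemma restrict_prod (S T : scube R X) (P : {set 'I_(cube_dim S)})
    (Q : {set 'I_(cube_dim T)}) e :
  @cube_restrict _ _ (scube_prod mu S T) (set_join P Q) e =
  scube_prod mu (cube_restrict P e) (cube_restrict Q e).
Proof.
(* The increasing enumeration of [set_join P Q]: first that of [P], then that of [Q]. *)
pose h (a : 'I_(#|P| + #|Q|)) : 'I_(cube_dim S + cube_dim T) :=
  match fintype.split a with
  | inl b => lshift _ (enum_val b) | inr b => rshift _ (enum_val b) end.
have hl b : h (lshift _ b) = lshift _ (enum_val b) by rewrite /h (unsplitK (inl b)).
have hr b : h (rshift _ b) = rshift _ (enum_val b) by rewrite /h (unsplitK (inr b)).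
apply: (@restrict_eq _ _ (scube_prod mu (cube_restrict P e) (cube_restrict Q e))
         (scube_prod mu S T) (set_join P Q) e h) => [a b|a|j|t u ut ue].
- rewrite -(splitK a) -(splitK b).
  case: (fintype.split a) => {}a; case: (fintype.split b) => {}b;
    rewrite /unsplit ?hl ?hr /=.
  + exact: enum_val_lt.
  + by move=> _; rewrite (leq_trans (ltn_ord _)) ?leq_addr.
  + by rewrite ltnNge (leq_trans (ltnW (ltn_ord b))) ?leq_addr.
  + by rewrite !ltn_add2l; exact: enum_val_lt.
- rewrite -(splitK a); case: (fintype.split a) => {}a; rewrite /unsplit ?hl ?hr.
    by rewrite set_joinl enum_valP.
  by rewrite set_joinr enum_valP.
- rewrite -(splitK j); case: (fintype.split j) => {}j;
    rewrite /unsplit ?set_joinl ?set_joinr => jP.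
    by exists (lshift _ (enum_rank_in jP j)); rewrite hl enum_rankK_in.
  by exists (rshift _ (enum_rank_in jP j)); rewrite hr enum_rankK_in.
congr (mu (_, _)); apply/esym; apply: restrict_fun => [a|j jP].
- by rewrite -hl ut.
- by rewrite ue ?set_joinl.
- by rewrite -hr ut.
- by rewrite ue ?set_joinr.
Qed.

Lemma CU_comult_mul_cube (S T : scube R X) :
  delta (cube_class S ** cube_class T) =
  \sum_P \sum_Q
    (shuffle_sign P * shuffle_sign Q * (-1) ^+ (#|~: P| * #|Q|)) *:
    tens (cube_class (cube_restrict P (unitI0 R)) **
          cube_class (cube_restrict Q (unitI0 R)))
         (cube_class (@cube_restrict _ _ S (~: P) (unitI1 R)) **
          cube_class (@cube_restrict _ _ T (~: Q) (unitI1 R))).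
Proof.
rewrite CU_mulE CU_comultE.
rewrite [LHS]sum_set_join; apply: eq_bigr => P _; apply: eq_bigr => Q _.
by rewrite shuffle_sign_join setC_join !CU_mulE !restrict_prod.
Qed.

(** Keeping [Q] outside makes the right side linear in [delta x]. The second tensor factor of a term
    of [delta x] has dimension [#|~: P|], so the crossing sign is exactly [CU_sign #|Q|] on that
    factor. *)
Lemma CU_comult_mul_cuber (x : CU) (T : scube R X) :
  delta (x ** cube_class T) =
  \sum_Q shuffle_sign Q *:
    tmap (CU_mul_flip mu (cube_class (cube_restrict Q (unitI0 R))))
         (CU_mul_flip mu (cube_class (@cube_restrict _ _ T (~: Q) (unitI1 R)))
            \o CU_sign #|Q|) (delta x).
Proof.
move: x; apply: CU_linear_ext => [a x x'|a x x'|S].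
- by rewrite CU_mul_linearl linearP.
- rewrite scaler_sumr -big_split; apply: eq_bigr => Q _.
  by rewrite [delta _]linearP tmapD tmapZ scalerDr !scalerA mulrC.
rewrite CU_comult_mul_cube exchange_big; apply: eq_bigr => Q _.
rewrite CU_comultE tmap_sum scaler_sumr; apply: eq_bigr => P _.
rewrite tmapZ tmapE scalerA.
rewrite -[RHS]/(_ *: tens (_ ** _) (CU_sign #|Q| _ ** _)) CU_signE.
by rewrite CU_mulZl tensZr scalerA [_ * shuffle_sign P]mulrC.
Qed.

(* The coproduct of [x] is a sum of two pure tensors, so multiplying by it in
   [CU (x) CU] is the sum of two maps induced on the tensor square. *)
Lemma CU_comult_mul d (e g x y : CU) :
  x \in CU_deg X d -> g \in CU_deg X 0 -> delta x = tens x g + tens e x ->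
  delta (x ** y) = tmap (CU_mul mu x) (CU_mul mu g) (delta y) +
                   tmap (CU_mul mu e \o CU_sign d) (CU_mul mu x) (delta y).
Proof.
move=> xd g0 dx; move: y; apply: CU_linear_ext => [a y y'|a y y'|T].
- by rewrite CU_mul_linearr linearP.
- by rewrite [delta _]linearP !tmapD !tmapZ scalerDr addrACA.
rewrite CU_comult_mul_cuber CU_comultE dx !tmap_sum -big_split.
apply: eq_bigr => Q _; rewrite tmapD !tmapZ !tmapE.
apply: etrans (scalerDr _ _ _) _; congr (_ *: _ + _ *: _).
  rewrite -[LHS]/(tens (_ ** _) (CU_sign #|Q| g ** _)).
  by rewrite (CU_sign_deg _ g0) mul0n expr0 scale1r.
rewrite -[LHS]/(tens (_ ** _) (CU_sign #|Q| x ** _)).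
rewrite -[RHS]/(tens (e ** CU_sign d _) _).
rewrite (CU_sign_deg _ xd) CU_signE CU_mulZr CU_mulZl.
by rewrite tensZl tensZr [(d * _)%N]mulnC.
Qed.

(** For factors that are primitive up to the 0-chains [e], [g], [h]. The first bracket has the same
    shape again; the second holds the mixed terms, which must cancel in a sum of such products. *)
Lemma CU_comult_mul_quasi m n (e g h x y : CU) :
  x \in CU_deg X m -> y \in CU_deg X n -> e \in CU_deg X 0 -> g \in CU_deg X 0 ->
  delta x = tens x g + tens e x -> delta y = tens y h + tens e y ->
  delta (x ** y) = (tens (x ** y) (g ** h) + tens (e ** e) (x ** y)) +
    (tens (x ** e) (g ** y) + (-1) ^+ (n * m) *: tens (e ** y) (x ** h)).
Proof.
move=> xm yn e0 g0 dx dy.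
rewrite (CU_comult_mul y xm g0 dx) dy !tmapD !tmapE.
rewrite -[LHS]/(tens _ _ + tens _ _ +
  (tens (e ** CU_sign m y) _ + tens (e ** CU_sign m e) _)).
rewrite (CU_sign_deg _ yn) (CU_sign_deg _ e0) mul0n expr0 scale1r.
rewrite CU_mulZr tensZl.
by rewrite [X in _ + X]addrC addrACA.
Qed.

End Comultiplication.

(** * The coproduct of a cone *)

Section ConeComultiplication.
Context {R : realType} {k : comNzRingType}.
Local Notation CU := (CU R k (real_line R)).
Local Notation delta := (@CU_comult R k _).

Lemma restrictT {X : topologicalType} (T : scube R X) e :
  cube_restrict [set: 'I_(cube_dim T)] e = T.
Proof.
apply: (@restrict_eq _ _ T T setT e id) => // [a|j _|t u ut _].
- by rewrite inE.
- by exists j.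
- by congr scube_fun; apply/funext.
Qed.

Lemma restrict_coneT (A : scube R (real_line R)) (P : {set 'I_(cube_dim A)}) e :
  @cube_restrict _ _ (scube_cone A) (@set_join 1 _ [set: 'I_1] P) e =
  scube_cone (cube_restrict P e).
Proof.
pose h (a : 'I_(1 + #|P|)) : 'I_(1 + cube_dim A) :=
  match fintype.split a with inl b => lshift _ b | inr b => rshift _ (enum_val b) end.
have hl b : h (lshift _ b) = lshift _ b by rewrite /h (unsplitK (inl b)).
have hr b : h (rshift _ b) = rshift _ (enum_val b) by rewrite /h (unsplitK (inr b)).
apply: (@restrict_eq _ _ (scube_cone (cube_restrict P e))
         (scube_cone A) (@set_join 1 _ setT P) e h) => [a b|a|j|t u ut ue].
- rewrite -(@splitK 1 _ a) -(@splitK 1 _ b).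
  case: (@fintype.split 1 _ a) => {}a; case: (@fintype.split 1 _ b) => {}b;
    rewrite /unsplit ?hl ?hr //=.
  + by rewrite !ord1.
  + by rewrite [b]ord1.
  + by rewrite !ltn_add2l; exact: enum_val_lt.
- rewrite -(@splitK 1 _ a); case: (@fintype.split 1 _ a) => {}a; rewrite /unsplit ?hl ?hr.
    exact: etrans (@set_joinl 1 (cube_dim A) _ _ _) (finset.in_setT _).
  exact: etrans (@set_joinr 1 (cube_dim A) _ _ _) (enum_valP _).
- rewrite -(@splitK 1 _ j); case: (@fintype.split 1 _ j) => {}j; rewrite /unsplit => jP.
    by exists (@lshift 1 #|P| j); rewrite hl.
  have {}jP : j \in P := etrans (esym (@set_joinr 1 (cube_dim A) _ _ _)) jP.
  by exists (@rshift 1 #|P| (enum_rank_in jP j)); rewrite hr enum_rankK_in.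
have r1 l (j : 'I_l) : @rshift 1 l j = lift ord0 j :> 'I_l.+1 by exact: rshift1.
have l1 l : lshift l (@ord0 0) = @ord0 l by exact: ord_inj.
(* The cone coordinate is kept by the restriction, so the scaling factor is the same on both
   sides. *)
have ut0 : u ord0 = t ord0 by have := ut (@lshift 1 #|P| ord0); rewrite hl !l1.
rewrite [LHS]/(unitI_val (u ord0) * scube_fun A _ : R) ut0.
congr (_ * _ : R); apply/esym; apply: restrict_fun => [a|j jP].
  by rewrite -!r1 -hr ut.
rewrite -r1 ue // (contra _ jP) // => jP'.
exact: etrans (esym (@set_joinr 1 (cube_dim A) _ _ _)) jP'.
Qed.

Lemma restrict_cone1 (A : scube R (real_line R)) (P : {set 'I_(cube_dim A)}) :
  @cube_restrict _ _ (scube_cone A) (@set_join 1 _ set0 P) (unitI1 R) =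
  cube_restrict P (unitI1 R).
Proof.
apply: (@restrict_eq _ _ (cube_restrict P (unitI1 R))
         (scube_cone A) (@set_join 1 _ set0 P) (unitI1 R)
         (fun a => lift ord0 (enum_val a))).
- by move=> a b ab; rewrite !lift0 ltnS; exact: enum_val_lt.
- move=> a; rewrite -rshift1.
  exact: etrans (@set_joinr 1 (cube_dim A) _ _ _) (enum_valP _).
- move=> j; rewrite -(@splitK 1 _ j); case: (@fintype.split 1 _ j) => {}j;
    rewrite /unsplit => jP.
    by have := etrans (esym (@set_joinl 1 (cube_dim A) _ _ _)) jP; rewrite inE.
  have {}jP : j \in P := etrans (esym (@set_joinr 1 (cube_dim A) _ _ _)) jP.
  by exists (enum_rank_in jP j); rewrite enum_rankK_in // -rshift1.
move=> t u ut ue.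
have l1 l : lshift l (@ord0 0) = @ord0 l by exact: ord_inj.
rewrite [LHS]/(unitI_val (u ord0) * scube_fun A _ : R).
rewrite ue; last first.
  rewrite -l1; apply/negP => j0.
  by have := etrans (esym (@set_joinl 1 (cube_dim A) _ _ _)) j0; rewrite inE.
apply: etrans (mul1r _) _; apply/esym; apply: restrict_fun => // j jP.
rewrite ue // -rshift1 (contra _ jP) // => jP'.
exact: etrans (esym (@set_joinr 1 (cube_dim A) _ _ _)) jP'.
Qed.

Lemma restrict_cone_fun0 (A : scube R (real_line R)) (P : {set 'I_(cube_dim A)}) t :
  scube_fun (@cube_restrict _ _ (scube_cone A) (@set_join 1 _ set0 P) (unitI0 R)) t
  = 0 :> R.
Proof.
pose u (j : 'I_(cube_dim (scube_cone A))) : unitI R :=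
  if [pick a | enum_val a == j] is Some a then t a else unitI0 R.
have l1 l : lshift l (@ord0 0) = @ord0 l by exact: ord_inj.
have ue j : j \notin @set_join 1 _ set0 P -> u j = unitI0 R.
  by rewrite /u; case: pickP => // a /eqP <-; rewrite enum_valP.
rewrite (@restrict_fun _ _ _ _ _ _ u) // => [|a].
  rewrite [LHS]/(unitI_val (u ord0) * scube_fun A _ : R).
  rewrite ue; first exact: mul0r.
  rewrite -l1; apply/negP => j0.
  by have := etrans (esym (@set_joinl 1 (cube_dim A) _ _ _)) j0; rewrite inE.
rewrite /u; case: pickP => [b /eqP/enum_val_inj -> //|/(_ a)].
by rewrite eqxx.
Qed.

Lemma restrict_cone0_degenerate (A : scube R (real_line R)) (P : {set 'I_(cube_dim A)}) :
  P != set0 ->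
  degenerate (@cube_restrict _ _ (scube_cone A) (@set_join 1 _ set0 P) (unitI0 R)).
Proof.
case/set0Pn => j jP.
have jP' : rshift 1 j \in @set_join 1 _ set0 P by rewrite set_joinr.
exists (enum_rank_in jP' (rshift 1 j)) => t t' _.
by rewrite [LHS]restrict_cone_fun0 [RHS]restrict_cone_fun0.
Qed.

Lemma restrict_cone0 (A : scube R (real_line R)) :
  @cube_restrict _ _ (scube_cone A) (@set_join 1 _ set0 set0) (unitI0 R) =
  point_cube R (0 : real_line R).
Proof.
have E : #|@set_join 1 (cube_dim A) set0 set0| = 0%N.
  apply/eqP; rewrite cards_eq0; apply/eqP/setP => j.
  by rewrite !inE; case: fintype.split => a; rewrite inE.
apply: (@scube_eq _ _
  (@cube_restrict _ _ (scube_cone A) (@set_join 1 _ set0 set0) (unitI0 R))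
  (point_cube R (0 : real_line R))).
  exact: E.
by move=> t u _; rewrite [LHS]restrict_cone_fun0.
Qed.

Lemma sum_set1 (V : nmodType) (F : {set 'I_1} -> V) :
  \sum_P F P = F set0 + F setT.
Proof.
rewrite (bigD1 set0) //= (bigD1 setT) /=; last first.
  by apply/eqP => /setP/(_ ord0); rewrite !inE.
rewrite big1 ?addr0 // => P /andP[P0 PT]; exfalso.
case/negP: PT; case/set0Pn: P0 => i iP; apply/eqP/setP => j.
by rewrite inE [j]ord1 -(ord1 i).
Qed.

(** The subsets are sorted by whether they contain the cone coordinate. If not, the left factor is
    constantly 0, so only the empty subset survives and gives the first term. If so, the left factor
    is a cone, while the right factor has cone coordinate 1 and is a restriction of the original
    cube. *)
Lemma CU_comult_sigma (x : CU) :
  delta (CU_sigma x) = tens (cube_class (point_cube R (0 : real_line R))) (CU_sigma x) +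
                       tmap CU_sigma idfun (delta x).
Proof.
move: x; apply: CU_linear_ext => [a x x'|a x x'|A].
- by rewrite !linearP.
- rewrite [CU_sigma _]linearP [delta (_ + _)]linearP tens_linearr.
  by rewrite tmapD tmapZ scalerDr addrACA.
rewrite CU_sigmaE !CU_comultE.
have -> : CU_comult_cube (scube_cone A) = \sum_(P : {set 'I_1})
    \sum_(Q : {set 'I_(cube_dim A)})
    (shuffle_sign P * shuffle_sign Q * (-1) ^+ (#|~: P| * #|Q|)) *:
    tens (cube_class (@cube_restrict _ _ (scube_cone A) (set_join P Q) (unitI0 R)))
         (cube_class (@cube_restrict _ _ (scube_cone A) (set_join (~: P) (~: Q))
                        (unitI1 R))) :> tensor CU CU.
  rewrite [LHS](@sum_set_join 1 (cube_dim A)).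
  apply: eq_bigr => P _; apply: eq_bigr => Q _.
  by rewrite (@shuffle_sign_join 1 (cube_dim A)) (@setC_join 1 (cube_dim A)).
rewrite sum_set1; congr (_ + _).
  rewrite (bigD1 set0) //= [X in _ + X]big1 ?addr0 => [|P P0].
    rewrite !setC0 cards0 muln0 expr0 mulr1.
    rewrite restrict_cone0 restrict_coneT restrictT.
    by rewrite !shuffle_sign0 mulr1 scale1r.
  rewrite (cube_class_degenerate (restrict_cone0_degenerate P0)).
  by rewrite tens0l scaler0.
rewrite tmap_sum; apply: eq_bigr => P _.
rewrite setCT cards0 mul0n expr0 mulr1.
rewrite restrict_coneT restrict_cone1 tmapZ tmapE CU_sigmaE.
by rewrite shuffle_signT mul1r.
Qed.

End ConeComultiplication.

(** * Vertices of cubes, and the exponential on sums and natural numbers *)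

Section PointFaces.
Context {R : realType} {X : topologicalType}.

Lemma restrict0 (T : scube R X) e :
  @cube_restrict _ _ T set0 e = point_cube R (scube_fun T (fun=> e)).
Proof.
have E : #|set0 : {set 'I_(cube_dim T)}| = 0%N by rewrite cards0.
apply: (@scube_eq _ _ (@cube_restrict _ _ T set0 e)
  (point_cube R (scube_fun T (fun=> e))) E) => t u _.
rewrite (@restrict_fun _ _ T set0 e t (fun=> e)) // => a.
by have := enum_valP a; rewrite inE.
Qed.

End PointFaces.

Section Circle.
Context (R : realType).

Lemma exp2piD (a b : R) :
  exp2pi R (a + b) = circle_mul R (exp2pi R a, exp2pi R b).
Proof.
apply: val_inj => /=; rewrite /exp2pi_fun /circle_val /= mulrDr cosD sinD; simpc.
by congr (_ +i* _)%C; rewrite addrC [X in _ + X]mulrC.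
Qed.

Lemma exp2pi_nat n : exp2pi R n%:R = circle1 R.
Proof.
have circ1 (z : circle R) : circle_mul R (z, circle1 R) = z.
  by apply: val_inj => /=; exact: mulr1.
elim: n => [|n IHn].
  by apply: val_inj => /=; rewrite /= mulr0 cos0 sin0.
rewrite -natr1 exp2piD IHn -[RHS]circ1; congr (circle_mul R (_, _)).
by apply: val_inj => /=; rewrite mulr1 mulr_natl cos2pi sin2pi.
Qed.

End Circle.

(** Both sides sum [F a b c] over all triples with [a + b + c = n]. *)
Lemma sum_triangle (V : nmodType) (F : nat -> nat -> nat -> V) n :
  \sum_(0 <= i < n.+1) \sum_(0 <= j < i.+1) F j (i - j)%N (n - i)%N =
  \sum_(0 <= i < n.+1) \sum_(0 <= j < (n - i).+1) F i j (n - i - j)%N.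
Proof.
transitivity (\sum_(0 <= i < n.+1) \sum_(0 <= j < n.+1 | (j <= i)%N)
    F j (i - j)%N (n - i)%N).
  apply: eq_big_nat => i /andP[_ iN].
  rewrite (big_nat_widen _ _ n.+1) //=.
transitivity (\sum_(0 <= j < n.+1) \sum_(0 <= i < n.+1 | (j <= i)%N)
    F j (i - j)%N (n - i)%N).
  by rewrite (exchange_big_dep_nat xpredT).
apply: eq_big_nat => j /andP[_ jn].
transitivity (\sum_(j <= i < n.+1) F j (i - j)%N (n - i)%N).
  by rewrite (big_nat_widenl j 0).
rewrite -{1}[j]add0n big_addn subSn //.
by apply: eq_bigr => i _; rewrite addnK addnC subnDA.
Qed.

(** * Degree, differential and coproduct of the chains on the real line *)

Section Recursion.
Context (R : realType) (k : comNzRingType).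
Local Notation CU := (CU R k (real_line R)).
Local Notation T := (Ttilde R k).
Local Notation "x ** y" := (CU_mul (real_add R) x y) (at level 40, left associativity).
Local Notation delta := (@CU_comult R k _).
Local Notation pt c := (cube_class (point_cube R (c : real_line R))).

Definition Tconv n : CU := \sum_(0 <= i < n.+1) T i ** T (n - i).

Lemma TtildeS n : T n.+1 = CU_sigma (Tconv n).
Proof. by rewrite TtildeE // big_add1 /=. Qed.

Lemma Ttilde_deg n : T n \in CU_deg (real_line R) n.*2.+1.
Proof.
elim/ltn_ind: n => -[|n] IHn; first exact: (cube_class_deg (interval_cube R)).
rewrite TtildeS doubleS; apply: CU_sigma_deg; rewrite /Tconv big_nat.
apply: rpred_sum => i /andP[_ iN]; have : (i + (n - i) = n)%N by rewrite subnKC.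
move=> /(congr1 (fun n => n.*2.+2)); rewrite doubleD -addSn -addnS => <-.
by apply: CU_mul_deg; apply: IHn => //; rewrite ltnS leq_subr.
Qed.

Lemma Tconv_deg n : Tconv n \in CU_deg (real_line R) n.*2.+2.
Proof.
rewrite /Tconv big_nat.
apply: rpred_sum => i /andP[_ iN]; have : (i + (n - i) = n)%N by rewrite subnKC.
move=> /(congr1 (fun n => n.*2.+2)); rewrite doubleD -addSn -addnS => <-.
by apply: CU_mul_deg; exact: Ttilde_deg.
Qed.

Lemma CU_d_Ttilde0 : CU_d (T 0) = pt 1 - pt 0.
Proof.
rewrite [T 0]/(cube_class _) CU_dE /CU_d_cube big_ord1 expr1 scaleN1r opprB.
by congr (cube_class _ - cube_class _); apply: face_eq => // t u _ ue;
  rewrite [LHS]/(unitI_val (u ord0)) ue.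
Qed.

Lemma CU_d_Ttilde n : CU_d (T n.+1) = Tconv n.
Proof.
elim/ltn_ind: n => n IHn; rewrite TtildeS (CU_d_sigma (Tconv_deg n)).
suff -> : CU_d (Tconv n) = 0 by rewrite linear0 subr0.
have comm c (x : CU) : pt c ** x = x ** pt c.
  by apply: CU_mul_point_comm => z; exact: addrC.
have realA x y z :
  real_add R (x, real_add R (y, z)) = real_add R (real_add R (x, y), z).
  exact: addrA.
rewrite linear_sum.
(* The Leibniz sign is -1 because every [T i] has odd degree. *)
have -> : \sum_(0 <= i < n.+1) CU_d (T i ** T (n - i)) =
    \sum_(0 <= i < n.+1) CU_d (T i) ** T (n - i) -
    \sum_(0 <= i < n.+1) T i ** CU_d (T (n - i)).
  rewrite -sumrB; apply: eq_bigr => i _; rewrite CU_d_mul.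
  rewrite (CU_sign_deg _ (Ttilde_deg i)) muln1 exprS -signr_odd odd_double mulr1.
  by rewrite CU_mulZl scaleN1r.
(* The terms with [CU_d (T 0)], to which the induction hypothesis does not apply, are split off from
   both sums. *)
have -> : \sum_(0 <= i < n.+1) T i ** CU_d (T (n - i)) =
    \sum_(0 <= i < n) T i ** CU_d (T (n - i)) + T n ** CU_d (T 0).
  by rewrite big_nat_recr // subnn.
have -> : \sum_(0 <= i < n.+1) CU_d (T i) ** T (n - i) =
    CU_d (T 0) ** T n + \sum_(0 <= i < n) CU_d (T i.+1) ** T (n - i.+1).
  by rewrite big_nat_recl // subn0.
rewrite CU_d_Ttilde0.
have -> : T n ** (pt 1 - pt 0) = (pt 1 - pt 0) ** T n.
  by rewrite CU_mulBr CU_mulBl !comm.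
rewrite [X in _ - X]addrC opprD addrACA subrr add0r.
case: n => [|n] in IHn *; first by rewrite !big_nil subrr.
apply/eqP; rewrite subr_eq0; apply/eqP.
(* By induction both remaining sums run over the triple products with indices of total [n],
   bracketed to the left in one and to the right in the other. *)
transitivity (\sum_(0 <= i < n.+1) \sum_(0 <= j < i.+1) T j ** T (i - j) ** T (n - i)).
  apply: eq_big_nat => i /andP[_ iN].
  by rewrite IHn // CU_mul_suml.
rewrite (sum_triangle (fun a b c => T a ** T b ** T c)).
apply: eq_big_nat => i /andP[_ iN].
rewrite subSn // IHn ?ltnS ?leq_subr // CU_mul_sumr.
by apply: eq_bigr => j _; rewrite CU_mulA.
Qed.

(** The number [n.+1] is the value of the cubes of [T n] at the vertex with all coordinates 1: it is
    1 for [n = 0], and the recursion adds the values of two factors whose indices have total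
    [n - 1]. *)
Lemma CU_comult_Ttilde n : delta (T n) = tens (T n) (pt n.+1%:R) + tens (pt 0) (T n).
Proof.
elim/ltn_ind: n => -[_|n IHn].
  rewrite [T 0]/(cube_class _) CU_comultE /CU_comult_cube.
  rewrite [LHS]sum_set1 shuffle_sign0 shuffle_signT !scale1r setC0 setCT.
  rewrite !restrictT !restrict0 addrC; congr (tens _ (cube_class (point_cube R _)) + _).
(* The cone over the point 0 is a constant 1-cube. This removes the term that [CU_comult_sigma]
   produces from the summand [tens (pt 0) _]. *)
have sig0 : CU_sigma (pt 0) = 0 :> CU.
  rewrite CU_sigmaE cube_class_degenerate //; exists ord0 => t t' _.
  by rewrite [LHS]mulr0 [RHS]mulr0.
have ptD c d : pt c ** pt d = pt (c + d) :> CU by rewrite CU_mul_points.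
have mul0 (x : CU) : x ** pt 0 = x by apply: CU_mul_unit => z; exact: addr0.
have comm c (x : CU) : pt c ** x = x ** pt c.
  by apply: CU_mul_point_comm => z; exact: addrC.
have pt_deg c : pt c \in CU_deg (k := k) (real_line R) 0 by exact: cube_class_deg.
suff dconv : delta (Tconv n) = tens (Tconv n) (pt n.+2%:R) + tens (pt 0) (Tconv n).
  rewrite TtildeS CU_comult_sigma dconv tmapD !tmapE sig0 tens0l addr0.
  by rewrite addrC.
rewrite /Tconv linear_sum tens_suml tens_sumr -big_split.
(* The mixed terms form two sums, of opposite sign because all degrees are odd, which are exchanged
   by replacing [i] with [n - i]. *)
transitivity (\sum_(0 <= i < n.+1)
   (tens (T i ** T (n - i)) (pt n.+2%:R) + tens (pt 0) (T i ** T (n - i))) +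
   (\sum_(0 <= i < n.+1) tens (T i) (T (n - i) ** pt i.+1%:R) -
    \sum_(0 <= i < n.+1) tens (T (n - i)) (T i ** pt (n - i).+1%:R))).
  rewrite -sumrB -big_split; apply: eq_big_nat => i /andP[_ iN].
  have ni : (n - i < n.+1)%N by rewrite ltnS leq_subr.
  rewrite (CU_comult_mul_quasi _ (Ttilde_deg i) (Ttilde_deg (n - i)) (pt_deg 0)
    (pt_deg i.+1%:R) (IHn i iN) (IHn _ ni)).
  rewrite !mul0 ptD -natrD addSn addnS subnKC // !comm mul0.
  by rewrite -signr_odd oddM /= !odd_double expr1 scaleN1r.
rewrite [X in _ - X]big_nat_rev /= [X in _ + (_ - X)](_ : _ =
  \sum_(0 <= i < n.+1) tens (T i) (T (n - i) ** pt i.+1%:R)) ?subrr ?addr0 //.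
apply: eq_big_nat => i /andP[_ iN].
by rewrite add0n subSS subKn.
Qed.

End Recursion.

(** * Angles on the unit circle and continuous integer-valued functions *)

Section Trigonometry.
Context {R : realType}.
Implicit Types a b x y : R.

Lemma cos_sin_atan a b : 0 < a -> a ^+ 2 + b ^+ 2 = 1 ->
  cos (atan (b / a)) = a /\ sin (atan (b / a)) = b.
Proof.
move=> a0 ab; have an0 : a != 0 by rewrite gt_eqF.
have cE : cos (atan (b / a)) = a.
  rewrite cos_atan (_ : 1 + _ = a^-1 ^+ 2).
    by rewrite sqrtr_sqr ger0_norm ?invrK // invr_ge0 ltW.
  apply: (@mulfI _ (a ^+ 2)); first by rewrite expf_neq0.
  rewrite mulrDr mulr1 -!exprMn mulrCA divff // mulr1 expr1n ab.
  by [].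
split=> //; have := atanK (b / a); rewrite /tan cE => /(congr1 ( *%R^~ a)).
by rewrite !divfK.
Qed.

Lemma cos_sin_surj a b : a ^+ 2 + b ^+ 2 = 1 -> exists x, cos x = a /\ sin x = b.
Proof.
move=> ab.
have a1 : -1 <= a <= 1.
  rewrite -ler_norml -(ler_pXn2r (n := 2)) ?nnegrE //.
  by rewrite expr1n real_normK ?num_real // -ab lerDl sqr_ge0.
have sE : sin (acos a) = `|b|.
  by rewrite sin_acos // -ab addrC addKr sqrtr_sqr.
have [b0|b0] := leP 0 b.
  by exists (acos a); rewrite acosK ?in_itv // sE ger0_norm.
by exists (- acos a); rewrite cosN sinN acosK ?in_itv // sE ltr0_norm ?opprK.
Qed.

(** Periodicity reduces to the fractional part and evenness to the interval from 0 to 1/2, on which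
    the cosine of [2 * pi * y] is injective. *)
Lemma cos_eq1 x : cos (2 * pi * x) = 1 -> exists m : int, x = m%:~R.
Proof.
have cosn y (n : nat) : cos (2 * pi * (y + n%:R)) = cos (2 * pi * y).
  rewrite mulrDr [2 * pi * n%:R]mulr_natr mulr_natl.
  exact: (periodicn (@cosD2pi R)).
have cosz y (m : int) : cos (2 * pi * (y + m%:~R)) = cos (2 * pi * y).
  case: m => n; first exact: cosn.
  by rewrite NegzE mulrNz -pmulrn -[in RHS](subrK n.+1%:R y) cosn.
have itv01 y : 0 <= y -> y <= 1 / 2 -> cos (2 * pi * y) = 1 -> y = 0.
  move=> y0 y1 cy; have pi0 := pi_gt0 R.
  have : 2 * pi * y = 0 by apply: cos_inj; rewrite ?in_itv /= ?cy ?cos0 //; nra.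
  by move/eqP; rewrite !mulf_eq0 pnatr_eq0 (gt_eqF pi0) /= => /eqP.
move=> cx; exists (Num.floor x).
have /andP[lo hi] := floor_itv x; rewrite intrD mulr1z in hi.
have := cosz (x - (Num.floor x)%:~R) (Num.floor x); rewrite subrK cx => /esym cr.
have [h|h] := leP (x - (Num.floor x)%:~R) (1 / 2).
  by apply/eqP; rewrite -subr_eq0; apply/eqP/itv01 => //; rewrite subr_ge0.
have := itv01 (1 - (x - (Num.floor x)%:~R)).
have -> : cos (2 * pi * (1 - (x - (Num.floor x)%:~R))) = 1.
  by rewrite addrC -[1]/(1%:~R) cosz mulrN cosN.
move=> h1; have : 1 - (x - (Num.floor x)%:~R) = 0 by apply: h1 => //; lra.
lra.
Qed.

(** Otherwise the intermediate value theorem yields a half-integer value, namely the smaller of the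
    two end values plus 1/2. *)
Lemma continuous_int_valued (D : R -> R) : continuous D ->
  (forall x, exists m : int, D x = m%:~R) -> D 0 = D 1.
Proof.
move=> cD Dint.
have nohalf (m z : int) : m%:~R + 1 / 2 != z%:~R :> R.
  apply/eqP => /(congr1 ( *%R 2)); rewrite mulrDr mul1r divff ?pnatr_eq0 // => h.
  have : (2 * m + 1)%:~R = (2 * z)%:~R :> R by rewrite intrD !intrM.
  by move/intr_inj; lia.
have cD01 : {within `[0, 1], continuous D}%classic by exact: continuous_subspaceT.
case: (Dint 0) (Dint 1) => [a Da] [b Db].
have [ab|ab|ab] := ltgtP a b; last by rewrite Da Db ab.
- have ab' : a%:~R + 1 <= b%:~R :> R by rewrite -[1]/(1%:~R) -intrD ler_int lezD1.
  have [|c _ Dc] := IVT (v := a%:~R + 1 / 2) ler01 cD01.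
    by rewrite Da Db ge_min le_max; apply/andP; split; apply/orP; [left|right]; lra.
  by case: (Dint c) => z Dz; have := nohalf a z; rewrite -Dc Dz eqxx.
- have ab' : b%:~R + 1 <= a%:~R :> R by rewrite -[1]/(1%:~R) -intrD ler_int lezD1.
  have [|c _ Dc] := IVT (v := b%:~R + 1 / 2) ler01 cD01.
    by rewrite Da Db ge_min le_max; apply/andP; split; apply/orP; [right|left]; lra.
  by case: (Dint c) => z Dz; have := nohalf b z; rewrite -Dc Dz eqxx.
Qed.

End Trigonometry.

(** * Lifting a map from a cube to the unit circle to a continuous angle *)

Section Lifting.
Context {R : realType}.
Local Open Scope classical_set_scope.
Local Open Scope ring_scope.

Fact clamp_subproof (r : R) : Num.max 0 (Num.min 1 r) \in (`[0, 1]%classic : set R).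
Proof.
apply: mem_set; rewrite /= in_itv /= le_max lexx /= ge_max ler01 /=.
by rewrite ge_min lexx.
Qed.

(** The retraction of the line onto the interval. It makes scaling a cube and following its diagonal
    total functions of a real parameter. *)
Definition clampI (r : R) : unitI R := exist _ (Num.max 0 (Num.min 1 r)) (clamp_subproof r).

Lemma clampI_continuous : continuous clampI.
Proof.
apply: (@continuous_comp_initial _ _ _ (set_val : unitI R -> R)) => x.
apply: (@continuous_max R R (cst 0) (cst 1 \min id)); first exact: cst_continuous.
by apply: continuous_min; first exact: cst_continuous.
Qed.

Lemma clampIK (u : unitI R) : clampI (unitI_val u) = u.
Proof.
apply: val_inj; case: u => r r01 /=; have := set_mem r01; rewrite /= in_itv /=.
by case/andP => r0 r1; rewrite /unitI_val /= (min_idPr r1) (max_idPr r0).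
Qed.

Definition cube_scale n (p : R * cube R n) : cube R n :=
  fun i => clampI (p.1 * unitI_val (p.2 i)).

Lemma cube_scale_continuous n : continuous (@cube_scale n).
Proof.
apply: continuous_cube => i p.
apply: (@continuous_comp _ _ _ (fun p : R * cube R n => p.1 * unitI_val (p.2 i)) clampI);
  last exact: clampI_continuous.
apply: cvgM; first exact: cvg_fst.
have c2 : {for p, continuous (fun p : R * cube R n => p.2)} by exact: cvg_snd.
exact: (continuous_comp (continuous_comp c2 (@cube_coord_continuous R n i _))
  (@unitI_val_continuous R _)).
Qed.

Lemma cube_compact n : compact [set: cube R n]%classic.
Proof.
have cI : compact [set: unitI R]%classic.
  have -> : [set: unitI R]%classic = (clampI @` `[0, 1])%classic.
    apply/seteqP; split=> // u _; exists (unitI_val u); last exact: clampIK.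
    by case: u => r r01; exact: set_mem r01.
  apply: continuous_compact; last exact: segment_compact.
  by apply: continuous_subspaceT; exact: clampI_continuous.
have := @tychonoff 'I_n (fun=> unitI R) (fun=> [set: unitI R]%classic) (fun=> cI).
by congr compact; apply/seteqP; split.
Qed.

(* Along the contraction of the cube to its origin, the ratio of the values of
   the map at times [r] and [r + 1/(N+1)] lies in the right half-plane once [N]
   is large, uniformly by compactness; the arguments of these ratios are
   continuous and add up to a lift. *)
Lemma cube_lift n (c s : cube R n -> R) : continuous c -> continuous s ->
  (forall t, c t ^+ 2 + s t ^+ 2 = 1) ->
  exists th : cube R n -> R,
    continuous th /\ forall t, cos (th t) = c t /\ sin (th t) = s t.
Proof.
move=> cc cs cs1.
pose sc (r : R) (x : cube R n) := cube_scale (r, x).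
(* [C] and [S] are the real and imaginary parts of the ratio of the value at time [r'] to the value
   at time [r]. *)
pose C r r' x := c (sc r x) * c (sc r' x) + s (sc r x) * s (sc r' x).
pose S r r' x := c (sc r x) * s (sc r' x) - s (sc r x) * c (sc r' x).
have CS1 r r' x : C r r' x ^+ 2 + S r r' x ^+ 2 = 1.
  rewrite -[RHS]mulr1 -{1}(cs1 (sc r x)) -(cs1 (sc r' x)) /C /S; ring.
have cr (f : cube R n -> R) r : continuous f -> continuous (fun x => f (sc r x)).
  move=> cf x; apply: (continuous_comp _ (cf _)).
  apply: (@continuous_comp _ _ _ (fun x => (r, x)) (@cube_scale n));
    last exact: cube_scale_continuous.
  have h1 : {for x, continuous (fun _ : cube R n => r)} by exact: cst_continuous.
  have h2 : {for x, continuous (fun y : cube R n => y)} by exact: cvg_id.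
  exact: (cvg_pair h1 h2).
have [N HN] : exists N : nat, forall r x, 0 <= r <= 1 ->
    0 < C r (r + N.+1%:R^-1) x.
  pose G (q : (R * cube R n) * R) := C q.1.1 (q.1.1 + q.2) q.1.2.
  have cG : continuous G.
    move=> q.
    have c1 : continuous (fun q : (R * cube R n) * R => cube_scale q.1).
      move=> {}q; apply: (@continuous_comp _ _ _ fst (@cube_scale n));
        last exact: cube_scale_continuous.
      exact: cvg_fst.
    have c2 : continuous (fun q : (R * cube R n) * R => cube_scale (q.1.1 + q.2, q.1.2)).
      move=> {}q; apply: (@continuous_comp _ _ _
        (fun q : (R * cube R n) * R => (q.1.1 + q.2, q.1.2)) (@cube_scale n));
        last exact: cube_scale_continuous.
      have cf : {for q, continuous (fun q : (R * cube R n) * R => q.1)} by exact: cvg_fst.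
      have h1 : {for q, continuous (fun q : (R * cube R n) * R => q.1.1)}.
        by apply: (continuous_comp cf); exact: cvg_fst.
      have h2 : {for q, continuous (fun q : (R * cube R n) * R => q.1.2)}.
        by apply: (continuous_comp cf); exact: cvg_snd.
      have h3 : {for q, continuous (fun q : (R * cube R n) * R => q.2)} by exact: cvg_snd.
      exact: (cvg_pair (cvgD h1 h3) h2).
    by apply: cvgD; apply: cvgM;
      [exact: (continuous_comp (c1 q) (cc _))|exact: (continuous_comp (c2 q) (cc _))
      |exact: (continuous_comp (c1 q) (cs _))|exact: (continuous_comp (c2 q) (cs _))].
  have K : compact ((`[0, 1] : set R) `*` [set: cube R n])%classic.
    exact: compact_setX (@segment_compact R 0 1) (@cube_compact n).
  (* At step size 0 the function [G] equals 1, so it is positive near each point for large [N];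
     compactness yields one [N] for all points. *)
  have /(compact_near_coveringP _).1/(_ _ \oo%classic (fun N p => 0 < G (p, N.+1%:R^-1))) := K.
  case.
  - move=> p _.
    have G0 : 0 < G (p, 0).
      by rewrite /G /C addr0 -!expr2 cs1.
    have : (fun pN : (R * cube R n) * nat => G (pN.1, pN.2.+1%:R^-1)) @
        filter_prod (nbhs p) \oo --> G (p, 0).
      have h1 : (fun pN : (R * cube R n) * nat => pN.1) @ filter_prod (nbhs p) \oo --> p.
        exact: cvg_fst.
      have h2 : (fun pN : (R * cube R n) * nat => pN.2.+1%:R^-1 : R) @
          filter_prod (nbhs p) \oo --> (0 : R).
        apply: (cvg_comp (G := \oo) snd (fun N => N.+1%:R^-1 : R)); first exact: cvg_snd.
        exact: cvg_harmonic.
      exact: (cvg_comp _ _ (cvg_pair h1 h2) (cG (p, 0))).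
    by move/(cvgr_gt _)/(_ _ G0).
  move=> N _ HN; exists N => r x r01.
  by apply: (HN N (leqnn _) (r, x)); split.
have step j : (j <= N.+1)%N -> exists th : cube R n -> R,
    continuous th /\ forall t, cos (th t) = c (sc (j%:R / N.+1%:R) t) /\
                               sin (th t) = s (sc (j%:R / N.+1%:R) t).
  elim: j => [_|j IHj jN].
    (* At time 0 the whole cube is contracted to its origin, so a constant angle is a lift. *)
    have sc0 t : sc (0%:R / N.+1%:R) t = sc 0 (fun=> unitI0 R).
      by apply/funext => i; rewrite /sc /cube_scale /= !mul0r.
    have [th0 [h1 h2]] := cos_sin_surj (cs1 (sc 0 (fun=> unitI0 R))).
    by exists (cst th0); split=> [|t]; [exact: cst_continuous|rewrite !sc0].
  have [th [cth hth]] := IHj (ltnW jN).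
  pose r : R := j%:R / N.+1%:R; pose r' : R := j.+1%:R / N.+1%:R.
  have r'E : r' = r + N.+1%:R^-1 by rewrite /r' -natr1 mulrDl mul1r.
  have C0 t : 0 < C r r' t.
    rewrite r'E; apply: HN; rewrite divr_ge0 //= ler_pdivrMr ?ltr0n // mul1r.
    by rewrite ler_nat ltnW.
  exists (fun t => th t + atan (S r r' t / C r r' t)); split=> [t|t].
    have hc rr : {for t, continuous (fun t => c (sc rr t))} by exact: cr.
    have hs rr : {for t, continuous (fun t => s (sc rr t))} by exact: cr.
    have hC : {for t, continuous (C r r')}.
      exact: (cvgD (cvgM (hc r) (hc r')) (cvgM (hs r) (hs r'))).
    have hS : {for t, continuous (S r r')}.
      exact: (cvgB (cvgM (hc r) (hs r')) (cvgM (hs r) (hc r'))).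
    have hSC : {for t, continuous (fun t => S r r' t / C r r' t)}.
      by apply: (cvgM hS (cvgV _ hC)); rewrite gt_eqF.
    exact: (cvgD (cth t) (continuous_comp hSC (@continuous_atan R _))).
  have [h1 h2] := cos_sin_atan (C0 t) (CS1 r r' t).
  have [h3 h4] := hth t.
  rewrite cosD sinD h1 h2 h3 h4 -/r -/r' /C /S; split.
    by rewrite -[RHS]mul1r -(cs1 (sc r t)); ring.
  by rewrite -[RHS]mul1r -(cs1 (sc r t)); ring.
have [th [cth hth]] := step _ (leqnn N.+1).
exists th; split=> // t; have := hth t; rewrite divff ?pnatr_eq0 //.
suff -> : sc 1 t = t by [].
by apply/funext => i; rewrite /sc /cube_scale /= mul1r clampIK.
Qed.

End Lifting.

(** * Lifts of cubes in the circle and the winding cocycle *)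

Section Winding.
Context (R : realType).

Definition is_lift (T : scube R (circle R)) (th : cube R (cube_dim T) -> R) :=
  continuous th /\ forall t, exp2pi R (th t) = scube_fun T t.

Lemma circle_eq (z w : circle R) :
  complex.Re (circle_val z) = complex.Re (circle_val w) ->
  complex.Im (circle_val z) = complex.Im (circle_val w) -> z = w.
Proof.
move=> re im; apply: val_inj; apply/eqP; rewrite eq_complex.
by apply/andP; split; apply/eqP.
Qed.

Lemma Re_continuous : continuous (fun z : R[i]^o => complex.Re z : R).
Proof.
move=> z; have FF := nbhs_filter z; apply/cvgrPdist_lt => e e0.
(* The norm of [R[i]^o] takes values in [R[i]], so the radius has to be embedded there. *)
have /cvgrPdist_lt/(_ e%:C%C) : {for z, continuous (fun z : R[i]^o => z)} by exact: cvg_id.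
rewrite ltcR => /(_ e0); apply: filterS => w.
by move=> /(le_lt_trans (normc_ge_Re _)); rewrite ltcR raddfB.
Qed.

Lemma Im_continuous : continuous (fun z : R[i]^o => complex.Im z : R).
Proof.
have normc_ge_Im (z : R[i]) : `|complex.Im z|%:C%C <= `|z|.
  case: z => x y; rewrite normc_def lecR /= -sqrtr_sqr.
  by rewrite ler_sqrt ?addr_ge0 ?sqr_ge0 // lerDr sqr_ge0.
move=> z; have FF := nbhs_filter z; apply/cvgrPdist_lt => e e0.
have /cvgrPdist_lt/(_ e%:C%C) : {for z, continuous (fun z : R[i]^o => z)} by exact: cvg_id.
rewrite ltcR => /(_ e0); apply: filterS => w.
by move=> /(le_lt_trans (normc_ge_Im _)); rewrite ltcR raddfB.
Qed.

Lemma circle_Re_continuous : continuous (fun z : circle R => complex.Re (circle_val z)).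
Proof.
have cv : continuous (@circle_val R) by exact: initial_continuous.
by move=> z; exact: continuous_comp (cv z) (@Re_continuous _).
Qed.

Lemma circle_Im_continuous : continuous (fun z : circle R => complex.Im (circle_val z)).
Proof.
have cv : continuous (@circle_val R) by exact: initial_continuous.
by move=> z; exact: continuous_comp (cv z) (@Im_continuous _).
Qed.

Lemma circle_Re2Im2 (z : circle R) :
  complex.Re (circle_val z) ^+ 2 + complex.Im (circle_val z) ^+ 2 = 1.
Proof.
have := circle_val_norm z; rewrite normc_def => -[] /(congr1 (fun x => x ^+ 2)).
by rewrite sqr_sqrtr ?addr_ge0 ?sqr_ge0 // expr1n.
Qed.

Lemma exists_lift (T : scube R (circle R)) : exists th, @is_lift T th.
Proof.
have [th [cth hth]] := cube_lift
  (fun t => continuous_comp (@scube_continuous _ _ T t) (@circle_Re_continuous _))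
  (fun t => continuous_comp (@scube_continuous _ _ T t) (@circle_Im_continuous _))
  (fun t => circle_Re2Im2 (scube_fun T t)).
exists (fun t => (2 * pi)^-1 * th t); split=> [t|t].
  have h : {for t, continuous (fun _ : cube R (cube_dim T) => (2 * pi)^-1 : R)}.
    exact: cst_continuous.
  exact: (cvgM h (cth t)).
have pi0 : 2 * pi != 0 :> R by rewrite mulf_neq0 ?pnatr_eq0 // gt_eqF // pi_gt0.
by case: (hth t) => c s; apply: circle_eq; rewrite /= mulVKf.
Qed.

(** Along the diagonal of the cube two lifts differ by a continuous integer-valued function. They
    thus differ by the same integer at both ends, and the floor commutes with adding an integer. *)
Lemma lift_increment (T : scube R (circle R)) th th' :
  @is_lift T th -> @is_lift T th' ->
  Num.floor (th (fun=> unitI1 R)) - Num.floor (th (fun=> unitI0 R)) =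
  Num.floor (th' (fun=> unitI1 R)) - Num.floor (th' (fun=> unitI0 R)).
Proof.
move=> [cth hth] [cth' hth'].
pose dg (r : R) : cube R (cube_dim T) := fun=> clampI r.
have cdg : continuous dg.
  by apply: continuous_cube => i r; exact: clampI_continuous.
have c1 : continuous (fun r => th (dg r)).
  by move=> r; exact: continuous_comp (cdg r) (cth _).
have c2 : continuous (fun r => th' (dg r)).
  by move=> r; exact: continuous_comp (cdg r) (cth' _).
have cD : continuous (fun r => th (dg r) - th' (dg r)).
  by move=> r; exact: (cvgB (c1 r) (c2 r)).
have Dint r : exists m : int, th (dg r) - th' (dg r) = m%:~R.
  apply: cos_eq1; have := hth (dg r); rewrite -(hth' (dg r)).
  move/(congr1 (@circle_val R)) => [c s].
  by rewrite mulrBr cosB c s -!expr2 cos2Dsin2.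
have D01 := continuous_int_valued cD Dint.
have [m Dm] := Dint 0.
have dg0 : dg 0 = (fun=> unitI0 R).
  by apply/funext => i; rewrite /dg -[unitI0 R]clampIK.
have dg1 : dg 1 = (fun=> unitI1 R).
  by apply/funext => i; rewrite /dg -[unitI1 R]clampIK.
have h0 : th (fun=> unitI0 R) = th' (fun=> unitI0 R) + m%:~R.
  by rewrite -dg0 -Dm addrC subrK.
have h1 : th (fun=> unitI1 R) = th' (fun=> unitI1 R) + m%:~R.
  by rewrite -dg1 -Dm D01 addrC subrK.
by rewrite h0 h1 !floorDrz ?intr_int // opprD addrACA subrr addr0.
Qed.

(** The floors make the value an integer independent of the lift even for paths that are not closed;
    on loops it is the usual winding number. *)
Definition winding (T : scube R (circle R)) : int :=
  let th := projT1 (cid (exists_lift T)) in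
  Num.floor (th (fun=> unitI1 R)) - Num.floor (th (fun=> unitI0 R)).

Lemma windingE T th : @is_lift T th ->
  winding T = Num.floor (th (fun=> unitI1 R)) - Num.floor (th (fun=> unitI0 R)).
Proof. by move=> l; apply: lift_increment => //; exact: (projT2 (cid _)). Qed.

Lemma winding_const T : (forall t t', scube_fun T t = scube_fun T t') -> winding T = 0.
Proof.
move=> Tc; have [th [_ hth]] := exists_lift T.
rewrite (@windingE T (fun=> th (fun=> unitI0 R))) ?subrr //.
by split=> [|t]; [exact: cst_continuous|rewrite (Tc t (fun=> unitI0 R)) -hth].
Qed.

Lemma winding_face T th (i : 'I_(cube_dim T)) e : @is_lift T th ->
  winding (cube_face i e) =
  Num.floor (th (fun j => if j == i then e else unitI1 R)) -
  Num.floor (th (fun j => if j == i then e else unitI0 R)).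
Proof.
move=> [cth hth].
pose h (j : 'I_(cube_dim T)) : 'I_(cube_dim T).-1 + unitI R :=
  if unlift i j is Some j' then inl j' else inr e.
rewrite (@windingE (cube_face i e) (fun t => th (plug h t))); last first.
  split=> [t|t]; last exact: hth.
  apply: (@continuous_comp _ _ _ (plug_fun h) th t); last exact: cth.
  exact: plug_continuous.
by congr (Num.floor (th _) - Num.floor (th _)); apply/funext => j;
  rewrite /= /mkcts /plug_fun /h; case: unliftP => [j' ->|->];
  rewrite ?eqxx // eq_sym (negPf (neq_lift _ _)).
Qed.

Context (k : comNzRingType).

Definition winding1 (T : scube R (circle R)) : k^o :=
  if cube_dim T == 1%N then (winding T)%:~R else 0.

Fact winding1_degenerate T : degenerate T -> winding1 T = 0.
Proof.
rewrite /winding1 => -[i Ti]; case: eqP => // T1.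
have ord_eq0 (j : 'I_(cube_dim T)) : j = 0%N :> nat.
  by have := ltn_ord j; rewrite [X in (_ < X)%N]T1 ltnS leqn0 => /eqP.
rewrite winding_const // => t t'; apply: Ti => j.
by case/eqP; apply/ord_inj; rewrite !ord_eq0.
Qed.

Definition winding_cochain : {linear CU R k (circle R) -> k^o} :=
  CU_lift winding1_degenerate.

(** A lift of a square restricts to lifts of its four edges, and each edge contributes the
    difference of the floors at its two ends. *)
Lemma winding_boundary (x : CU R k (circle R)) :
  x \in CU_deg (circle R) 2 -> winding_cochain (CU_d x) = 0.
Proof.
move: x; apply: CU_deg_ind => [|a x y Px Py|T T2].
- by rewrite !linear0.
- by rewrite !linearP Px Py scaler0 addr0.
case: T T2 => n T n2; have {}n2 : n = 2%N := n2; subst n.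
set T' : scube R (circle R) := existT _ 2%N T.
have [th lth] := exists_lift T'.
pose F (i : 'I_2) (e r : unitI R) : int :=
  Num.floor (th (fun j => if j == i then e else r)).
have wF (i : 'I_2) e : winding1 (@cube_face _ _ T' i e) =
    (F i e (unitI1 R) - F i e (unitI0 R))%:~R.
  by rewrite /winding1 (winding_face (T := T') i e lth).
rewrite CU_dE linear_sum.
transitivity (\sum_(i < 2) (-1) ^+ i.+1 *
    ((F i (unitI0 R) (unitI1 R) - F i (unitI0 R) (unitI0 R))%:~R -
     (F i (unitI1 R) (unitI1 R) - F i (unitI1 R) (unitI0 R))%:~R) : k).
  by apply: eq_bigr => i _; rewrite linearZZ linearB !CU_liftE !wF.
(* Each vertex lies on an edge in either direction. Once named uniformly, the four vertices each
   occur twice with opposite signs. *)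
have F1 e r : F (lift ord0 ord0) e r = F ord0 r e.
  congr (Num.floor (th _)); apply/funext => j.
  by case: (unliftP ord0 j) => [j' ->|->]; rewrite ?[j']ord1.
rewrite !big_ord_recl big_ord0 addr0 !F1 !intrB.
by rewrite lift0 expr1 expr2; ring.
Qed.

End Winding.

Theorem proposition6p6 (R : realType) (k : comNzRingType) :
  (forall n : nat, T_chain R k n \in CU_deg (circle R) n.*2.+1) /\
  (CU_d (T_chain R k 0) = 0 /\
   exists z : submodule (cycles (circle R) 1),
     \val z = T_chain R k 0 /\ homology_class z <> 0) /\
  (forall n : nat, (0 < n)%N ->
     CU_d (T_chain R k n) =
     \sum_(1 <= i < n.+1)
        CU_mul (circle_mul R) (T_chain R k i.-1) (T_chain R k (n - i))) /\
  (forall n : nat, CU_primitive (T_chain R k n)).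
Proof.
have Tdeg n : T_chain R k n \in CU_deg (circle R) n.*2.+1.
  exact: CU_map_deg (Ttilde_deg R k n).
have dT0 : CU_d (T_chain R k 0) = 0.
  (* The end points 0 and 1 of the interval have the same image in the circle. *)
  rewrite -CU_map_d CU_d_Ttilde0 linearB !CU_map_point.
  by rewrite (exp2pi_nat R 0) (exp2pi_nat R 1) subrr.
split=> //; split; last split.
- split=> //.
  have T0c : T_chain R k 0 \in cycles (circle R) 1.
    by apply/andP; split; [exact: (Tdeg 0%N)|exact/eqP].
  (* If [T_chain R k 0] bounded [y], the winding cocycle would vanish on it. The identity of the
     interval is a lift, so the value is 1, which is nonzero in [k]. *)
  exists (exist _ (T_chain R k 0) T0c); split=> // /quotmod_pi_eq0 /asboolP[y y2 dy].
  have := winding_boundary y2; rewrite (dy : CU_d y = T_chain R k 0).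
  rewrite [T_chain R k 0](CU_mapE (exp2pi R) (interval_cube R)) CU_liftE.
  rewrite /winding1 /= (@windingE R (scube_map (exp2pi R) (interval_cube R))
    (fun t => unitI_val (t ord0))); last first.
    by split; [exact: interval_cube_continuous|].
  rewrite [unitI_val (unitI1 R)]/(1 : R) [unitI_val (unitI0 R)]/(0 : R).
  by rewrite floor0 floor1 subr0 => /eqP; rewrite oner_eq0.
- case=> // n _; rewrite -CU_map_d CU_d_Ttilde /Tconv linear_sum big_add1.
  apply: eq_bigr => i _; rewrite subSS.
  by apply: CU_map_mul => a b; exact: exp2piD.
(* The points [n.+1] and 0 both map to the unit of the circle, which turns the formula on the line
   into primitivity. *)
move=> n; rewrite /CU_primitive CU_map_comult CU_comult_Ttilde tmapD !tmapE.
by rewrite !CU_map_point (exp2pi_nat R n.+1) (exp2pi_nat R 0).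
Qed.
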